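(* Let $H$ be a (closed) hemisphere of the unit sphere $S^2$, and let $N_N(t)$ and $N_D(t)$ be the eigenvalue counting functions of $-\Delta$ on $H$ with Neumann, respectively Dirichlet, boundary conditions on the boundary circle. Put $$\widetilde N_N(t)=\frac12t+\frac12\sqrt{t+\tfrac14}+\frac16,\qquad \widetilde N_D(t)=\frac12t-\frac12\sqrt{t+\tfrac14}+\frac16,$$ and let $A(t)$ denote either $\frac1t\int_0^t\big(N_N(s)-\widetilde N_N(s)\big)\,ds$ or $\frac1t\int_0^t\big(N_D(s)-\widetilde N_D(s)\big)\,ds$. Let $$g(x)=\frac16-2\Big(x-\big[x+\tfrac12\big]\Big)^2 .$$ Then, for either boundary condition, $$A(t)=\frac12\,g\Big(\sqrt{t+\tfrac14}\Big)+O(t^{-1/2})\qquad\text{as } t\to\infty.$$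
   Context: $[x]$ denotes the greatest integer $\le x$. $S^2$ is the round 2-sphere of radius 1 in $\mathbb R^3$. The eigenvalue counting function of an operator with discrete spectrum $0\le\lambda_1\le\lambda_2\le\cdots\to\infty$ (repeated according to multiplicity) is $N(t)=\#\{j:\lambda_j\le t\}$. *)

(* Defs.v *)
From mathcomp Require Import all_boot all_order all_algebra.
From mathcomp Require Import finmap.
From mathcomp Require Import all_classical all_reals all_analysis.

Set Implicit Arguments.
Unset Strict Implicit.
Unset Printing Implicit Defensive.

Import Order.TTheory GRing.Theory Num.Theory.
Import numFieldNormedType.Exports.

Local Open Scope classical_set_scope.
Local Open Scope ring_scope.

(** Euclidean structure of R^3. The library's norm `|x| on 'rV[R]_3 is the
    sup norm: it yields the right topology, but not the unit sphere. *)

Definition dot (R : realType) (x y : 'rV[R]_3) : R :=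
  \sum_(i < 3) x 0 i * y 0 i.

Definition enorm (R : realType) (x : 'rV[R]_3) : R := Num.sqrt (dot x x).

Definition sphere2 (R : realType) : set 'rV[R]_3 := [set x | enorm x = 1].

(** The closed hemisphere with pole [n] (a unit vector), its interior in the
    sphere, and its boundary circle. *)

Definition hemisphere (R : realType) (n : 'rV[R]_3) : set 'rV[R]_3 :=
  [set x | sphere2 x /\ 0 <= dot x n].

Definition hemisphere_interior (R : realType) (n : 'rV[R]_3) :
  set 'rV[R]_3 := [set x | sphere2 x /\ 0 < dot x n].

Definition hemisphere_boundary (R : realType) (n : 'rV[R]_3) :
  set 'rV[R]_3 := [set x | sphere2 x /\ dot x n = 0].

Definition partial (R : realType) (i : 'I_3) (f : 'rV[R]_3 -> R) :
  'rV[R]_3 -> R := fun x => 'D_(delta_mx 0 i) f x.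

Definition C1_on (R : realType) (U : set 'rV[R]_3) (f : 'rV[R]_3 -> R) : Prop :=
  forall (i : 'I_3) (x : 'rV[R]_3), U x ->
    derivable f x (delta_mx 0 i) /\ {for x, continuous (partial i f)}.

Definition C2_on (R : realType) (U : set 'rV[R]_3) (f : 'rV[R]_3 -> R) : Prop :=
  C1_on U f /\ forall i : 'I_3, C1_on U (partial i f).

Definition laplacian3 (R : realType) (f : 'rV[R]_3 -> R) (x : 'rV[R]_3) : R :=
  \sum_(i < 3) partial i (partial i f) x.

(** A function on a part of the sphere is represented by a function on R^3 of
    which only the values on the sphere are used; [radial_ext u] is its
    extension x |-> u (x / |x|), constant along rays. The Laplace-Beltrami
    operator of the unit sphere is the restriction to the sphere of the
    Laplacian of R^3 applied to this extension, and the tangential derivatives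
    of u are those of the extension. *)

Definition radial_ext (R : realType) (u : 'rV[R]_3 -> R) : 'rV[R]_3 -> R :=
  fun x => u ((enorm x)^-1 *: x).

Definition laplace_beltrami (R : realType) (u : 'rV[R]_3 -> R)
  (p : 'rV[R]_3) : R := laplacian3 (radial_ext u) p.

(** C^2 up to the boundary: [u] is C^2 on a neighbourhood in the sphere of the
    closed hemisphere. *)

Definition C2_hemisphere (R : realType) (n : 'rV[R]_3) (u : 'rV[R]_3 -> R) :
  Prop :=
  exists U : set 'rV[R]_3,
    [/\ open U, hemisphere n `<=` U & C2_on U (radial_ext u)].

Inductive boundary_condition := Neumann | Dirichlet.

(** At a boundary point the outward unit conormal is [- n], which is tangent to
    the sphere there. *)

Definition satisfies_bc (R : realType) (b : boundary_condition)
  (n : 'rV[R]_3) (u : 'rV[R]_3 -> R) : Prop :=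
  forall p : 'rV[R]_3, hemisphere_boundary n p ->
    match b with
    | Neumann => 'D_(- n) (radial_ext u) p = 0
    | Dirichlet => u p = 0
    end.

(** The eigenspace of - Delta for [mu] (zero function included). *)

Definition eigenspace_bc (R : realType) (b : boundary_condition)
  (n : 'rV[R]_3) (mu : R) : set ('rV[R]_3 -> R) :=
  [set u | [/\ C2_hemisphere n u, satisfies_bc b n u &
     forall p : 'rV[R]_3, hemisphere_interior n p ->
       - laplace_beltrami u p = mu * u p]].

(** [has_dim_on H E m]: the space of restrictions to [H] of the functions in
    [E] has a basis of size [m]. *)

Definition has_dim_on (R : realType) (T : Type) (H : set T)
  (E : set (T -> R)) (m : nat) : Prop :=
  exists e : 'I_m -> T -> R,
    [/\ forall i, E (e i),
        forall c : 'I_m -> R,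
          (forall p, H p -> \sum_(i < m) c i * e i p = 0) ->
          forall i, c i = 0
      & forall u, E u -> exists c : 'I_m -> R,
          forall p, H p -> u p = \sum_(i < m) c i * e i p].

(** [lam] is the sequence of eigenvalues in nondecreasing order, every
    eigenvalue being repeated according to its multiplicity. *)

Definition enumerates_eigenvalues (R : realType) (b : boundary_condition)
  (n : 'rV[R]_3) (lam : nat -> R) : Prop :=
  [/\ 0 <= lam 0%N,
      nondecreasing_seq lam,
      lam @ \oo --> +oo
    & forall mu : R, exists m : nat,
        has_dim_on (hemisphere n) (eigenspace_bc b n mu) m /\
        ([set j : nat | lam j = mu] #= `I_m)%card].

(** There is at most one such sequence, so [get] selects it; its existence is
    part of what has to be proved about [eigenvalues]. *)

Definition eigenvalues (R : realType) (b : boundary_condition)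
  (n : 'rV[R]_3) : R ^nat :=
  get [set lam : R ^nat | enumerates_eigenvalues b n lam].

Definition eigenvalue_count (R : realType) (b : boundary_condition)
  (n : 'rV[R]_3) (t : R) : R :=
  #|` fset_set [set j : nat | eigenvalues b n j <= t]|%:R.

Definition Ntilde (R : realType) (b : boundary_condition) (t : R) : R :=
  match b with
  | Neumann => 1 / 2 * t + 1 / 2 * Num.sqrt (t + 1 / 4) + 1 / 6
  | Dirichlet => 1 / 2 * t - 1 / 2 * Num.sqrt (t + 1 / 4) + 1 / 6
  end.

Definition averaged_error (R : realType) (b : boundary_condition)
  (n : 'rV[R]_3) (t : R) : R :=
  1 / t * \int[@lebesgue_measure R]_(s in `[0, t])
            (eigenvalue_count b n s - Ntilde b s).

Definition g (R : realType) (x : R) : R :=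
  1 / 6 - 2 * (x - (Num.floor (x + 1 / 2))%:~R) ^+ 2.

(* Main.v *)
From HB Require Import structures.
Require Import Defs.
From mathcomp Require Import all_boot all_order all_algebra.
From mathcomp Require Import finmap.
From mathcomp Require Import all_classical all_reals all_analysis.
From mathcomp Require Import ring lra zify.
Import Order.TTheory GRing.Theory Num.Theory.
Import numFieldNormedType.Exports.
Local Open Scope classical_set_scope.
Local Open Scope ring_scope.

Set Implicit Arguments.
Unset Strict Implicit.
Unset Printing Implicit Defensive.

(** The eigenvalues of the hemisphere are the numbers d (d + 1), with
    multiplicity d + 1 for the Neumann condition and d for the Dirichlet
    condition; everything else is a computation with sums over d < m.

    The spectrum is found through polynomial moments.  Let X, Y, Z be the
    coordinates in an orthonormal frame whose third vector is the pole, and put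
    s = 0 (Neumann) or s = 1 (Dirichlet), so that each monomial Z^s X^i Y^j
    satisfies the boundary condition.  On the sphere, with D = i + j + s,

      Delta (Z^s X^i Y^j) = i (i - 1) Z^s X^(i-2) Y^j
                            + j (j - 1) Z^s X^i Y^(j-2) - D (D + 1) Z^s X^i Y^j

    (laplace_beltrami_mono).  Green's formula (green_hemisphere), proved in
    spherical coordinates by integrating the two parts of the divergence in the
    order that makes each of them exact, turns this into a recursion for the
    moments M(i, j) of an eigenfunction u for mu:

      (D (D + 1) - mu) M(i, j) = i (i - 1) M(i-2, j) + j (j - 1) M(i, j-2)

    (moment_rec).  So all moments of u vanish as soon as those with
    D (D + 1) = mu do; and a function all of whose moments vanish is zero
    (eq0_of_moments: powers of a quadratic polynomial concentrate at any chosen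
    point of the hemisphere).  Hence there is no eigenvalue outside the numbers
    d (d + 1), and the eigenspace of k (k + 1) has dimension at most the number
    k + 1 - s of monomials of degree k.  Conversely the displayed formula is
    triangular in the degree, and D (D + 1) differs from k (k + 1) for D < k, so
    each monomial of degree k is the leading term of an eigenfunction
    (eigenfunction_exists); these are independent, which gives the dimension
    (has_dim_eigenspace).

    For the averages, let x = sqrt (t + 1/4).  Since d (d + 1) <= t means
    d + 1/2 <= x, the eigenvalues up to t are those with d < m, where
    m = [x + 1/2].  The integral of the counting function over [0, t] is the sum
    of the multiplicities times t - d (d + 1) over d < m, a polynomial in t and m
    (level_sumE).  Writing m = x - delta with |delta| <= 1/2 and subtracting the
    integral of the comparison function, the terms of degree 4 and 3 in x cancel
    and t (1/12 - delta^2) + O(x) remains (level_sum_expansion, remainder_le);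
    1/12 - delta^2 is g(x) / 2. *)

(** * Derivative rules *)

Section DerivativeRules.
Context {R : realType} {V : normedModType R}.
Implicit Types (f g : V -> R) (x v : V).

Lemma is_derive_fun_cst (c : R) x v : is_derive x v (fun _ : V => c) 0.
Proof. exact: is_derive_cst. Qed.

Lemma is_derive_funD f g x v (a b : R) : is_derive x v f a ->
  is_derive x v g b -> is_derive x v (fun y => f y + g y) (a + b).
Proof. exact: is_deriveD. Qed.

Lemma is_derive_funB f g x v (a b : R) : is_derive x v f a ->
  is_derive x v g b -> is_derive x v (fun y => f y - g y) (a - b).
Proof. exact: is_deriveB. Qed.

Lemma is_derive_funN f x v (a : R) : is_derive x v f a ->
  is_derive x v (fun y => - f y) (- a).
Proof. exact: is_deriveN. Qed.

Lemma is_derive_funM f g x v (a b : R) : is_derive x v f a ->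
  is_derive x v g b -> is_derive x v (fun y => f y * g y) (f x * b + g x * a).
Proof. exact: is_deriveM. Qed.

Lemma is_derive_funX f n x v (a : R) : is_derive x v f a ->
  is_derive x v (fun y => f y ^+ n) (n%:R * f x ^+ n.-1 * a).
Proof.
move=> df.
have -> : (fun y => f y ^+ n) = f ^+ n by apply/funext => y; rewrite fctE.
exact: is_deriveX.
Qed.

Lemma is_derive_funS n (h : 'I_n -> V -> R) x v (d : 'I_n -> R) :
  (forall i, is_derive x v (h i) (d i)) ->
  is_derive x v (fun y => \sum_(i < n) h i y) (\sum_(i < n) d i).
Proof.
move=> dh; rewrite (_ : (fun _ => _) = \sum_(i < n) h i).
  exact: is_derive_sum.
by apply/funext => y; rewrite fct_sumE.
Qed.

Lemma is_derive_line f x v (s a : R) : is_derive (x + s *: v) v f a ->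
  is_derive s (1 : R) (fun r : R => f (x + r *: v)) a.
Proof.
move=> [df <-].
have E : (fun h : R => h^-1 *: (((fun r : R => f (x + r *: v)) \o shift s) (h *: (1:R))
         - f (x + s *: v)))
       = (fun h : R => h^-1 *: ((f \o shift (x + s *: v)) (h *: v) - f (x + s *: v))).
  apply/funext => h /=; congr (_ *: (f _ - _)).
  by rewrite [h *: 1]mulr1 scalerDl addrCA.
by split; rewrite /derivable /derive E.
Qed.

Lemma is_derive_of_line f x v (a : R) :
  is_derive 0 (1 : R) (fun r : R => f (x + r *: v)) a -> is_derive x v f a.
Proof.
move=> [df <-].
have E : (fun h : R => h^-1 *: (((fun r : R => f (x + r *: v)) \o shift 0) (h *: (1:R))
         - f (x + 0 *: v)))
       = (fun h : R => h^-1 *: ((f \o shift x) (h *: v) - f x)).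
  apply/funext => h /=; rewrite scale0r !addr0; congr (_ *: (f _ - _)).
  by rewrite [h *: 1]mulr1 addrC.
by move: df; rewrite /derivable /derive E => df; split.
Qed.

Lemma is_derive_fun_comp (g : R -> R) f x v (a b : R) :
  is_derive (f x) 1 g b -> is_derive x v f a ->
  is_derive x v (fun y => g (f y)) (b * a).
Proof.
move=> dg df; apply: is_derive_of_line.
apply: (@is_derive1_comp _ g (fun r : R => f (x + r *: v))).
  by rewrite scale0r addr0.
by apply: is_derive_line; rewrite scale0r addr0.
Qed.

Lemma is_derive_ext f g x v (a b : R) : f =1 g -> a = b ->
  is_derive x v f a -> is_derive x v g b.
Proof. by move=> /funext <- <-. Qed.

End DerivativeRules.

Lemma MVT_line (R : realType) (V : normedModType R) (f : V -> R) x v (t : R) :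
  (forall c, 0 <= c <= 1 -> derivable f (x + (c * t) *: v) v) ->
  exists2 c : R, 0 <= c <= 1 &
    f (x + t *: v) - f x = 'D_v f (x + (c * t) *: v) * t.
Proof.
move=> df.
have dg (c : R) : 0 <= c <= 1 ->
    is_derive c 1 (fun r => f (x + (r * t) *: v)) ('D_v f (x + (c * t) *: v) * t).
  move=> c01; have H := derivableP (df c c01).
  apply: (@is_derive1_comp _ (fun r : R => f (x + r *: v)) (fun r : R => r * t) c).
    exact: is_derive_line.
  have := is_derive_funM (is_derive_id c (1 : R)) (is_derive_fun_cst t c (1 : R)).
  by rewrite mulr0 add0r mulr1.
have [||c c01 E] := @MVT_segment _ (fun r => f (x + (r * t) *: v))
   (fun c => 'D_v f (x + (c * t) *: v) * t) 0 1 ler01.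
- by move=> y /[!in_itv]/= /andP[y0 y1]; apply: dg; rewrite !ltW.
- apply: derivable_within_continuous => y /[!in_itv]/= y01.
  by case: (dg y y01).
- exists c; first by move: c01; rewrite in_itv.
  by move: E; rewrite mul1r mul0r scale0r addr0 subr0 mulr1.
Qed.

(** * Continuously differentiable functions of three variables *)

Section ContinuouslyDifferentiable.
Context {R : realType}.
Implicit Types (w : 'rV[R]_3 -> R) (U : set 'rV[R]_3) (x h : 'rV[R]_3).

Lemma rV3_sum x : x = \sum_(i < 3) x 0 i *: delta_mx 0 i.
Proof. exact: row_sum_delta. Qed.

Lemma norm_rV3_le x (r : R) : 0 <= r -> (forall i, `|x 0 i| <= r) -> `|x| <= r.
Proof.
move=> r0 xr; rewrite [leLHS]/Num.Def.normr/= mx_normrE.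
by apply: bigmax_le => // -[i j] _ /=; rewrite ord1.
Qed.

Lemma norm_coord_le x i : `|x 0 i| <= `|x|.
Proof.
rewrite [leRHS]/Num.Def.normr/= mx_normrE.
exact: (le_bigmax _ (fun ij => `|x ij.1 ij.2|) (0, i)).
Qed.

Lemma coord_rV3_continuous i : continuous (fun x : 'rV[R]_3 => x 0 i).
Proof. exact: coord_continuous. Qed.

(** Linear in h by construction; for continuously differentiable w it is the
    derivative along h (C1_on_derive). *)
Definition dirgrad w x h : R := \sum_(i < 3) h 0 i * partial i w x.

Lemma dirgradD w x (a : R) h h' :
  dirgrad w x (a *: h + h') = a * dirgrad w x h + dirgrad w x h'.
Proof.
rewrite /dirgrad mulr_sumr -big_split/=.
by apply: eq_bigr => i _; rewrite !mxE mulrDl mulrA.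
Qed.

Lemma dirgrad_linear w x : linear (dirgrad w x : 'rV[R]_3 -> R^o).
Proof. by move=> a u v; exact: dirgradD. Qed.

Lemma dirgrad_continuous w x : continuous (dirgrad w x).
Proof.
apply: continuous_big => //; first exact: add_continuous.
move=> i _ y; apply: (@continuousM R _ (fun h : 'rV[R]_3 => h 0 i) (fun=> partial i w x) y).
  exact: coord_rV3_continuous.
exact: cst_continuous.
Qed.

(** Along a segment parallel to an axis the mean value theorem compares the
    increment of w with a partial derivative at a nearby point, hence, by
    continuity, with the partial derivative at x. *)
Lemma C1_on_differentiable U w x : open U -> C1_on U w -> U x ->
  differentiable w x.
Proof.
move=> oU dw Ux.
pose L : {linear 'rV[R]_3 -> R^o} :=
  HB.pack (dirgrad w x : 'rV[R]_3 -> R^o) (GRing.isLinear.Build _ _ _ _ _ (dirgrad_linear w x)).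
have Lc : continuous L by exact: dirgrad_continuous.
suff E : (w : 'rV[R]_3 -> R^o) \o shift x = cst (w x : R^o) + L +o_ (0 : 'rV[R]_3) id.
  by apply/diff_locallyP; rewrite (diff_unique Lc E).
apply/eqaddoP => _/posnumP[e].
have e3 : 0 < e%:num / 3 by rewrite divr_gt0.
have Hn : \forall y \near x, U y /\ (forall i, `|partial i w x - partial i w y| <= e%:num / 3).
  near=> y; split; first by near: y; exact: open_nbhs_nbhs.
  near: y; apply: filter_forall => i.
  by have [_ /cvgrPdist_le/(_ _ e3)] := dw i x Ux.
have /nbhs_ballP[r /= r0 Hr] := Hn.
near=> h.
have hr : `|h| < r.
  near: h; apply/nbhs_ballP; exists r => // y.
  by rewrite -ball_normE/= sub0r normrN.
have Hb (v : 'rV[R]_3) : `|v| <= `|h| -> U (x + v) /\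
    forall i, `|partial i w x - partial i w (x + v)| <= e%:num / 3.
  move=> vh; apply: Hr; rewrite -ball_normE/= opprD addrA subrr sub0r normrN.
  exact: le_lt_trans vh hr.
have step (k : 'I_3) (v : 'rV[R]_3) :
    (forall c, 0 <= c <= 1 -> `|v + (c * h 0 k) *: delta_mx 0 k| <= `|h|) ->
    `|w (x + v + h 0 k *: delta_mx 0 k) - w (x + v) - h 0 k * partial k w x|
      <= e%:num / 3 * `|h|.
  move=> Hv.
  have [c c01|c c01 ->] := @MVT_line _ _ w (x + v) (delta_mx 0 k) (h 0 k).
    rewrite -addrA; have [/(dw k)[]//] := Hb _ (Hv c c01).
  rewrite mulrC -mulrBr normrM mulrC -addrA ler_pM// ?norm_coord_le//.
  by rewrite distrC; case: (Hb _ (Hv c c01)).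
have Hd (a : 'I_3 -> R) : (forall i, `|a i| <= `|h 0 i|) ->
    `|\sum_(i < 3) a i *: (delta_mx 0 i : 'rV[R]_3)| <= `|h|.
  move=> ah; apply: norm_rV3_le => // j.
  rewrite summxE (bigD1 j)//= big1 ?addr0 => [|i ij].
    rewrite !mxE !eqxx mulr1; exact: le_trans (ah j) (norm_coord_le _ _).
  by rewrite !mxE eqxx/= eq_sym (negbTE ij) mulr0.
have shrink (c t : R) : 0 <= c <= 1 -> `|c * t| <= `|t|.
  move=> /andP[c0 c1]; rewrite normrM ger0_norm// -[leRHS]mul1r.
  by rewrite ler_wpM2r.
(* The increment along h is split into three increments parallel to the axes. *)
pose d (i : 'I_3) : 'rV[R]_3 := delta_mx 0 i.
pose i0 : 'I_3 := ord0; pose i1 : 'I_3 := lift ord0 ord0.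
pose i2 : 'I_3 := lift ord0 (lift ord0 ord0).
have S0 : `|w (x + 0 + h 0 i0 *: d i0) - w (x + 0) - h 0 i0 * partial i0 w x|
   <= e%:num / 3 * `|h|.
  apply: step => c c01.
  have := Hd (fun i => if i == i0 then c * h 0 i else 0).
  rewrite !big_ord_recl big_ord0/= !scale0r !addr0 add0r; apply => i.
  by case: ifP => _; rewrite ?normr0// shrink.
have S1 : `|w (x + h 0 i0 *: d i0 + h 0 i1 *: d i1) - w (x + h 0 i0 *: d i0)
   - h 0 i1 * partial i1 w x| <= e%:num / 3 * `|h|.
  apply: step => c c01.
  have := Hd (fun i => if i == i0 then h 0 i else if i == i1 then c * h 0 i else 0).
  rewrite !big_ord_recl big_ord0/= !scale0r !addr0; apply => i.
  by case: ifP => _ //; case: ifP => _; rewrite ?normr0// shrink.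
have S2 : `|w (x + (h 0 i0 *: d i0 + h 0 i1 *: d i1) + h 0 i2 *: d i2)
   - w (x + (h 0 i0 *: d i0 + h 0 i1 *: d i1))
   - h 0 i2 * partial i2 w x| <= e%:num / 3 * `|h|.
  apply: step => c c01.
  have := Hd (fun i => if i == i2 then c * h 0 i else h 0 i).
  rewrite !big_ord_recl big_ord0/= !addr0 addrA; apply => i.
  by case: ifP => _ //; rewrite shrink.
have Eh : h + x = x + (h 0 i0 *: d i0 + h 0 i1 *: d i1) + h 0 i2 *: d i2.
  by rewrite [in LHS](rV3_sum h) !big_ord_recl big_ord0 addr0 addrC !addrA.
rewrite /= !fctE/= Eh /dirgrad !big_ord_recl big_ord0 addr0.
move: S0 S1 S2; rewrite addr0 addrA -/i0 -/i1 -/i2.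
set p2 := w (_ + _ + _ + _); set p1 := w (x + _ + _); set p0 := w (x + _).
set q0 := h 0 i0 * _; set q1 := h 0 i1 * _; set q2 := h 0 i2 * _.
move=> S0 S1 S2.
have -> : p2 - (w x + (q0 + (q1 + q2))) = (p0 - w x - q0) + (p1 - p0 - q1) + (p2 - p1 - q2).
  by ring.
have -> : e%:num * `|h| = e%:num / 3 * `|h| + e%:num / 3 * `|h| + e%:num / 3 * `|h|.
  by field.
have tri (A B C D : R) : `|A| <= D -> `|B| <= D -> `|C| <= D -> `|A + B + C| <= D + D + D.
  move=> hA hB hC; rewrite (le_trans (ler_normD _ _))// lerD//.
  by rewrite (le_trans (ler_normD _ _))// lerD.
exact: (tri _ _ _ _ S0 S1 S2).
Unshelve. all: by end_near. Qed.

Lemma C1_on_continuous U w x : open U -> C1_on U w -> U x ->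
  {for x, continuous w}.
Proof.
by move=> oU dw Ux; apply: differentiable_continuous; exact: C1_on_differentiable Ux.
Qed.

Lemma C1_on_derive U w x h : open U -> C1_on U w -> U x ->
  'D_h w x = dirgrad w x h.
Proof.
move=> oU dw Ux; have dfw := C1_on_differentiable oU dw Ux.
rewrite deriveE// {1}(rV3_sum h) linear_sum; apply: eq_bigr => i _.
by rewrite linearZ/= /partial deriveE.
Qed.

Lemma chain_rule U w (c : R -> 'rV[R]_3) (t : R) (d : 'rV[R]_3) :
  open U -> C1_on U w -> U (c t) ->
  (forall i, is_derive t (1 : R) (fun s => c s 0 i) (d 0 i)) ->
  is_derive t (1 : R) (fun s => w (c s)) (dirgrad w (c t) d).
Proof.
move=> oU dw Uct dc.
have dct : derivable c t 1.
  by apply/derivable_mxP => i j; rewrite ord1; case: (dc j).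
have Dc : 'D_1 c t = d.
  by rewrite derive_mx//; apply/rowP => j; rewrite mxE; case: (dc j).
have dfw := C1_on_differentiable oU dw Uct.
have dfc : differentiable c t by exact/derivable1_diffP.
have dfwc : differentiable (w \o c) t by exact: differentiable_comp.
split; first exact/derivable1_diffP.
rewrite -[LHS]/('D_1 (w \o c) t) deriveE// diff_comp//=.
by rewrite -(deriveE _ dfc) Dc -(deriveE _ dfw); exact: C1_on_derive Uct.
Qed.

End ContinuouslyDifferentiable.

(** * Orthonormal frames *)

Section Frames.
Context {R : realType}.
Implicit Types (a b n x y z u v : 'rV[R]_3).

Lemma dotE x y : dot x y = x 0 ord0 * y 0 ord0 + x 0 (lift ord0 ord0) * y 0 (lift ord0 ord0)
  + x 0 (lift ord0 (lift ord0 ord0)) * y 0 (lift ord0 (lift ord0 ord0)).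
Proof. by rewrite /dot !big_ord_recl big_ord0 addr0 addrA. Qed.

Lemma dotC x y : dot x y = dot y x.
Proof. by apply: eq_bigr => i _; rewrite mulrC. Qed.

Lemma dotDl x y z : dot (x + y) z = dot x z + dot y z.
Proof. by rewrite /dot -big_split/=; apply: eq_bigr => i _; rewrite !mxE mulrDl. Qed.

Lemma dotZl (c : R) x y : dot (c *: x) y = c * dot x y.
Proof. by rewrite /dot mulr_sumr; apply: eq_bigr => i _; rewrite !mxE mulrA. Qed.

Lemma dotDr x y z : dot x (y + z) = dot x y + dot x z.
Proof. by rewrite dotC dotDl !(dotC x). Qed.

Lemma dotZr (c : R) x y : dot x (c *: y) = c * dot x y.
Proof. by rewrite dotC dotZl (dotC x). Qed.

Lemma dot_ge0 x : 0 <= dot x x.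
Proof. by apply: sumr_ge0 => i _; rewrite -expr2 sqr_ge0. Qed.

Lemma sphere2P x : sphere2 x <-> dot x x = 1.
Proof.
rewrite /sphere2/= /enorm; split => [E|->]; last by rewrite sqrtr1.
by rewrite -(sqr_sqrtr (dot_ge0 x)) E expr1n.
Qed.

Definition orthoframe a b n : Prop :=
  [/\ dot a a = 1, dot b b = 1, dot n n = 1 & [/\ dot a b = 0, dot a n = 0 & dot b n = 0]].

(** The matrix with rows a, b, n has orthonormal rows, and a left inverse of a
    square matrix is also a right inverse, so its columns are orthonormal too. *)
Lemma orthoframe_resolution a b n : orthoframe a b n ->
  forall i j, a 0 i * a 0 j + b 0 i * b 0 j + n 0 i * n 0 j = (i == j)%:R.
Proof.
move=> [aa bb nn [ab an bn]] i j.
pose e (k : 'I_3) : 'rV[R]_3 := if k == ord0 then a else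
  if k == lift ord0 ord0 then b else n.
pose M : 'M[R]_3 := \matrix_(k, l) e k 0 l.
have MMt : M *m M^T = 1%:M.
  apply/matrixP => k l; rewrite !mxE.
  have -> : \sum_j0 M k j0 * M^T j0 l = dot (e k) (e l).
    by apply: eq_bigr => m _; rewrite !mxE.
  have e0 p : e (Ordinal (p : (0 < 3)%N)) = a by [].
  have e1 p : e (Ordinal (p : (1 < 3)%N)) = b by [].
  have e2 p : e (Ordinal (p : (2 < 3)%N)) = n by [].
  case: k => -[|[|[|//]]] kP; case: l => -[|[|[|//]]] lP;
    by rewrite ?e0 ?e1 ?e2 ?[dot b a]dotC ?[dot n a]dotC ?[dot n b]dotC.
have /matrixP/(_ i j) := mulmx1C MMt.
rewrite !mxE !big_ord_recl big_ord0 !mxE/= /e/= addr0 => <-.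
by rewrite addrA.
Qed.

Lemma orthoframe_exists n : sphere2 n -> exists a b, orthoframe a b n.
Proof.
move=> /sphere2P nn.
pose mk (p q r : R) : 'rV[R]_3 :=
  \row_k (if k == ord0 then p else if k == lift ord0 ord0 then q else r).
pose n0 := n 0 ord0; pose n1 := n 0 (lift ord0 ord0).
pose n2 := n 0 (lift ord0 (lift ord0 ord0)).
have nn' : n0 * n0 + n1 * n1 + n2 * n2 = 1 by rewrite -nn dotE.
have [z|nz] := eqVneq (n0 * n0 + n1 * n1) 0.
  have [z0 z1] : n0 = 0 /\ n1 = 0 by split; nra.
  exists (mk 1 0 0), (mk 0 1 0); rewrite /orthoframe !dotE !mxE/= -/n0 -/n1 -/n2 z0 z1.
  by split; [ring|ring|nra|split; ring].
have s0 : 0 < n0 * n0 + n1 * n1 by nra.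
pose s := Num.sqrt (n0 * n0 + n1 * n1).
have ss : s * s = n0 * n0 + n1 * n1 by rewrite -expr2 sqr_sqrtr ?ltW.
have sn0 : s != 0 by rewrite sqrtr_eq0 -ltNge.
have sE : s ^-1 * s^-1 * (n0 * n0 + n1 * n1) = 1 by rewrite -ss; field.
(* The first vector is horizontal and orthogonal to n; the second one is the
   cross product of n with the first. *)
exists (mk (- n1 / s) (n0 / s) 0), (mk (- n0 * n2 / s) (- n1 * n2 / s) s).
rewrite /orthoframe !dotE !mxE/= -/n0 -/n1 -/n2; split.
- by rewrite -[RHS]sE; ring.
- have -> : - n0 * n2 / s * (- n0 * n2 / s) + - n1 * n2 / s * (- n1 * n2 / s) + s * s
    = n2 * n2 * (s ^-1 * s^-1 * (n0 * n0 + n1 * n1)) + s * s by ring.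
  by rewrite sE ss mulr1 -nn'; ring.
- exact: nn'.
- split; [by ring|by ring|].
  have -> : - n0 * n2 / s * n0 + - n1 * n2 / s * n1 + s * n2 = n2 * s^-1 * (s * s -
    (n0 * n0 + n1 * n1)).
    by field.
  by rewrite ss subrr mulr0.
Qed.

End Frames.

(** * Second derivatives of functions constant along rays *)

Section SecondDerivatives.
Context {R : realType}.
Implicit Types (w u : 'rV[R]_3 -> R) (U : set 'rV[R]_3) (x y h k : 'rV[R]_3).

Definition hessian w x h k : R := \sum_(i < 3) h 0 i * dirgrad (partial i w) x k.

Lemma hessianE w x h k :
  hessian w x h k = \sum_(i < 3) \sum_(j < 3) h 0 i * k 0 j * partial j (partial i w) x.
Proof.
apply: eq_bigr => i _; rewrite mulr_sumr; apply: eq_bigr => j _.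
by rewrite mulrA.
Qed.

(** The Laplacian is the trace of the Hessian, and a trace can be computed in any
    orthonormal frame; this is what allows frames adapted to the sphere. *)
Lemma hessian_frame w x a b n : orthoframe a b n ->
  hessian w x a a + hessian w x b b + hessian w x n n = laplacian3 w x.
Proof.
move=> F; rewrite !hessianE -!big_split/=; apply: eq_bigr => i _.
rewrite -!big_split/= (bigD1 i)//= big1 ?addr0 => [|j ji];
  rewrite -!mulrDl (orthoframe_resolution F) ?eqxx ?mul1r//.
by rewrite eq_sym (negbTE ji) mul0r.
Qed.

Lemma is_derive_dirgrad U w (c v : R -> 'rV[R]_3) (t : R) (dc dv : 'rV[R]_3) :
  open U -> C2_on U w -> U (c t) ->
  (forall i, is_derive t (1 : R) (fun s => c s 0 i) (dc 0 i)) ->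
  (forall i, is_derive t (1 : R) (fun s => v s 0 i) (dv 0 i)) ->
  is_derive t (1 : R) (fun s => dirgrad w (c s) (v s))
    (hessian w (c t) (v t) dc + dirgrad w (c t) dv).
Proof.
move=> oU [_ d2w] Uct dct dvt; rewrite -big_split/=.
apply: is_derive_funS => i; rewrite [X in _ + X]mulrC; apply: is_derive_funM => //.
exact: (chain_rule oU (d2w i)).
Qed.

Lemma dot_homog (s : R) x : dot (s *: x) (s *: x) = s ^+ 2 * dot x x.
Proof. by rewrite dotZl dotZr mulrA expr2. Qed.

Lemma enorm_scale (s : R) x : 0 <= s -> enorm (s *: x) = s * enorm x.
Proof.
by move=> s0; rewrite /enorm dot_homog sqrtrM ?sqr_ge0// sqrtr_sqr ger0_norm.
Qed.

Lemma radial_ext_scale u (s : R) x : 0 < s -> radial_ext u (s *: x) = radial_ext u x.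
Proof.
move=> s0; rewrite /radial_ext enorm_scale ?ltW// scalerA invfM mulrAC mulVf ?gt_eqF//.
by rewrite mul1r.
Qed.

Lemma radial_ext_sphere u x : dot x x = 1 -> radial_ext u x = u x.
Proof. by move=> x1; rewrite /radial_ext /enorm x1 sqrtr1 invr1 scale1r. Qed.

Lemma is_derive_ray x (t : R) i :
  is_derive t (1 : R) (fun s : R => (s *: x) 0 i) (x 0 i).
Proof.
apply: (@is_derive_ext _ _ (fun s : R => s * x 0 i) _ _ _ (t * 0 + x 0 i * 1)).
- by move=> s; rewrite mxE.
- by rewrite mulr0 add0r mulr1.
- exact: is_derive_funM (is_derive_id _ _) (is_derive_fun_cst _ _ _).
Qed.

Lemma near_ray U x : open U -> U x -> \forall s \near (1 : R), 0 < s /\ U (s *: x).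
Proof.
move=> oU Ux; near=> s; split; first by near: s; exact: lt_nbhsr.
near: s.
have : (s *: x) @[s --> (1 : R)] --> (1 : R) *: x.
  by apply: cvgZr_tmp; exact: cvg_id.
rewrite scale1r => /(_ U); apply; exact: open_nbhs_nbhs.
Unshelve. all: by end_near. Qed.

(** Euler's identity for a function that is homogeneous of degree 0. *)
Lemma radial_ext_radial U u x : open U -> C1_on U (radial_ext u) -> U x ->
  dirgrad (radial_ext u) x x = 0.
Proof.
move=> oU dw Ux.
have [_ <-] : is_derive (1 : R) (1 : R) (fun s : R => radial_ext u (s *: x))
    (dirgrad (radial_ext u) x x).
  rewrite -{2}[x]scale1r; apply: (chain_rule oU dw); first by rewrite scale1r.
  exact: is_derive_ray.
rewrite -[RHS](derive_cst (radial_ext u x) (1 : R) (1 : R)).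
apply: near_eq_derive; near=> s; apply: radial_ext_scale.
by near: s; apply: lt_nbhsr.
Unshelve. all: by end_near. Qed.

(** Differentiate Euler's identity once more along the ray. *)
Lemma radial_ext_radial2 U u x : open U -> C2_on U (radial_ext u) -> U x ->
  hessian (radial_ext u) x x x = 0.
Proof.
move=> oU dw Ux.
have : is_derive (1 : R) (1 : R) (fun s : R => dirgrad (radial_ext u) (s *: x) x)
    (hessian (radial_ext u) (1 *: x) x x + dirgrad (radial_ext u) (1 *: x) 0).
  apply: (@is_derive_dirgrad U _ (fun s : R => s *: x) (fun=> x)) => //.
  - by rewrite scale1r.
  - exact: is_derive_ray.
  - by move=> i; rewrite mxE; exact: is_derive_fun_cst.
have -> : dirgrad (radial_ext u) (1 *: x) 0 = 0.
  by rewrite /dirgrad big1// => i _; rewrite mxE mul0r.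
rewrite addr0 scale1r => -[_ <-].
rewrite -[RHS](derive_cst (0 : R) (1 : R) (1 : R)).
apply: near_eq_derive; near=> s; rewrite /cst.
have [s0 Us] : 0 < s /\ U (s *: x) by near: s; exact: near_ray.
have := radial_ext_radial oU dw.1 Us.
rewrite -{2}[s *: x]addr0 dirgradD.
have -> : dirgrad (radial_ext u) (s *: x) 0 = 0.
  by rewrite /dirgrad big1// => i _; rewrite mxE mul0r.
by rewrite addr0 => /eqP; rewrite mulf_eq0 gt_eqF//= => /eqP.
Unshelve. all: by end_near. Qed.

End SecondDerivatives.

(** * The Laplace-Beltrami operator in spherical coordinates *)

Section SphericalCoordinates.
Context {R : realType} (a b n : 'rV[R]_3).
Hypothesis F : orthoframe a b n.

Definition comb (p q r : R) : 'rV[R]_3 := p *: a + q *: b + r *: n.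

Lemma dot_comb p q r p' q' r' :
  dot (comb p q r) (comb p' q' r') = p * p' + q * q' + r * r'.
Proof.
case: F => aa bb nn [ab an bn].
rewrite /comb !(dotDl, dotDr, dotZl, dotZr) (dotC b a) (dotC n a) (dotC n b).
by rewrite aa bb nn ab an bn; ring.
Qed.

Lemma dot_comb_a p q r : dot (comb p q r) a = p.
Proof.
by case: F => aa bb nn [ab an bn]; rewrite /comb !(dotDl, dotZl) (dotC b a) (dotC n a) aa ab an;
  ring.
Qed.

Lemma dot_comb_b p q r : dot (comb p q r) b = q.
Proof.
by case: F => aa bb nn [ab an bn]; rewrite /comb !(dotDl, dotZl) (dotC n b) bb ab bn; ring.
Qed.

Lemma dot_comb_n p q r : dot (comb p q r) n = r.
Proof.
by case: F => aa bb nn [ab an bn]; rewrite /comb !(dotDl, dotZl) an bn nn; ring.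
Qed.

Lemma comb_dot x : comb (dot x a) (dot x b) (dot x n) = x.
Proof.
apply/rowP => i; rewrite !mxE /dot !mulr_suml -!big_split/= (bigD1 i)//= big1 => [|j ji].
  rewrite addr0 -!mulrA -!mulrDr.
  by rewrite (orthoframe_resolution F) eqxx mulr1.
by rewrite -!mulrA -!mulrDr (orthoframe_resolution F) (negbTE ji) mulr0.
Qed.

(** t is the colatitude and p the longitude; pt_t and pt_p are the unit tangent
    vectors to the meridian and to the parallel. *)
Definition pt (t p : R) := comb (sin t * cos p) (sin t * sin p) (cos t).
Definition pt_t (t p : R) := comb (cos t * cos p) (cos t * sin p) (- sin t).
Definition pt_p (p : R) := comb (- sin p) (cos p) 0.

Lemma pt_orthoframe t p : orthoframe (pt t p) (pt_t t p) (pt_p p).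
Proof.
have t1 := cos2Dsin2 t; have p1 := cos2Dsin2 p.
rewrite /orthoframe /pt /pt_t /pt_p !dot_comb; split; [| | |split].
- have -> : sin t * cos p * (sin t * cos p) + sin t * sin p * (sin t * sin p) + cos t * cos t
    = sin t ^+ 2 * (cos p ^+ 2 + sin p ^+ 2) + cos t ^+ 2 by ring.
  by rewrite p1 mulr1 addrC.
- have -> : cos t * cos p * (cos t * cos p) + cos t * sin p * (cos t * sin p) + - sin t * - sin t
    = cos t ^+ 2 * (cos p ^+ 2 + sin p ^+ 2) + sin t ^+ 2 by ring.
  by rewrite p1 mulr1.
- by rewrite -p1; ring.
- have -> : sin t * cos p * (cos t * cos p) + sin t * sin p * (cos t * sin p) + cos t * - sin t
    = sin t * cos t * (cos p ^+ 2 + sin p ^+ 2) - cos t * sin t by ring.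
  by rewrite p1; ring.
- by ring.
- by ring.
Qed.

Lemma dot_pt t p : dot (pt t p) (pt t p) = 1.
Proof. by case: (pt_orthoframe t p). Qed.

Lemma is_derive_comb (p q r : R -> R) (t dp dq dr : R) i :
  is_derive t (1 : R) p dp -> is_derive t (1 : R) q dq -> is_derive t (1 : R) r dr ->
  is_derive t (1 : R) (fun s => comb (p s) (q s) (r s) 0 i) (comb dp dq dr 0 i).
Proof.
move=> hp hq hr.
have c0 (c : R) := @is_derive_fun_cst R R c t 1.
apply: (@is_derive_ext _ _ (fun s => p s * a 0 i + q s * b 0 i + r s * n 0 i) _ _ _
 (p t * 0 + a 0 i * dp + (q t * 0 + b 0 i * dq) + (r t * 0 + n 0 i * dr))).
- by move=> s; rewrite !mxE.
- by rewrite !mxE; ring.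
by do 2?apply: is_derive_funD; apply: is_derive_funM.
Qed.

Lemma is_derive_cMl (f : R -> R) (c t df : R) : is_derive t (1 : R) f df ->
  is_derive t (1 : R) (fun s => c * f s) (c * df).
Proof.
by move=> hf; have := is_derive_funM (is_derive_fun_cst c t (1 : R)) hf; rewrite mulr0 addr0.
Qed.

Lemma is_derive_cMr (f : R -> R) (c t df : R) : is_derive t (1 : R) f df ->
  is_derive t (1 : R) (fun s => f s * c) (df * c).
Proof.
move=> hf; have := is_derive_funM hf (is_derive_fun_cst c t (1 : R)).
by rewrite mulr0 add0r mulrC.
Qed.

Lemma is_derive_pt_t t p i :
  is_derive t (1 : R) (fun s => pt s p 0 i) (pt_t t p 0 i).
Proof.
by apply: is_derive_comb; apply: is_derive_cMr.
Qed.

Lemma is_derive_pt_tt t p i :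
  is_derive t (1 : R) (fun s => pt_t s p 0 i) ((- 1 *: pt t p) 0 i).
Proof.
apply: is_derive_eq.
  by apply: is_derive_comb; apply: is_derive_cMr || apply: is_derive_funN.
rewrite /pt_t /pt_p /pt /comb !mxE.
by rewrite ?scaler0 /GRing.scale/=; ring.
Qed.

Lemma is_derive_pt_p t p i :
  is_derive p (1 : R) (fun s => pt t s 0 i) ((sin t *: pt_p p) 0 i).
Proof.
apply: is_derive_eq.
  by apply: is_derive_comb; apply: is_derive_cMl || apply: is_derive_fun_cst.
rewrite /pt_t /pt_p /pt /comb !mxE.
by rewrite ?scaler0 /GRing.scale/=; ring.
Qed.

Lemma is_derive_pt_pp t p i :
  is_derive p (1 : R) (fun s => pt_p s 0 i)
    ((- sin t *: pt t p + - cos t *: pt_t t p) 0 i).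
Proof.
apply: is_derive_eq.
  by apply: is_derive_comb; apply: is_derive_funN || apply: is_derive_fun_cst.
rewrite /pt_t /pt_p /pt /comb !mxE.
have -> : - sin t * (sin t * cos p * a 0 i + sin t * sin p * b 0 i + cos t * n 0 i) +
  - cos t * (cos t * cos p * a 0 i + cos t * sin p * b 0 i + - sin t * n 0 i)
  = (cos t ^+ 2 + sin t ^+ 2) * (- cos p * a 0 i + - sin p * b 0 i) by ring.
by rewrite cos2Dsin2; ring.
Qed.

Lemma pt_t_pihalf p : pt_t (pi / 2) p = - n.
Proof.
by rewrite /pt_t /comb cos_pihalf sin_pihalf !mul0r !scale0r !add0r scaleN1r.
Qed.

Lemma pt_2pi t : pt t (2 * pi) = pt t 0.
Proof. by rewrite /pt [2 * pi]mulr_natl cos2pi sin2pi cos0 sin0. Qed.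

Lemma pt_p_2pi : pt_p (2 * pi) = pt_p 0.
Proof. by rewrite /pt_p [2 * pi]mulr_natl cos2pi sin2pi cos0 sin0. Qed.

Variables (U : set 'rV[R]_3) (u : 'rV[R]_3 -> R).
Hypotheses (oU : open U) (Cu : C2_on U (radial_ext u)).
Let w := radial_ext u.

(** On the sphere, sin t times the Laplacian is the derivative in t of sin t times
    the southward derivative, plus the derivative in p of the eastward derivative.
    The two terms are lap_t and lap_p, written with second derivatives of w in R^3
    so that nothing is divided by sin t and both stay continuous at the pole. *)
Definition flux_t t p := dirgrad w (pt t p) (pt_t t p).
Definition flux_p t p := dirgrad w (pt t p) (pt_p p).
Definition lap_t t p := cos t * flux_t t p + sin t * hessian w (pt t p) (pt_t t p) (pt_t t p).
Definition lap_p t p := sin t * hessian w (pt t p) (pt_p p) (pt_p p) - cos t * flux_t t p.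

Lemma dirgrad0 x : dirgrad w x 0 = 0.
Proof. by rewrite /dirgrad big1// => i _; rewrite mxE mul0r. Qed.

Lemma dirgradZ x (c : R) h : dirgrad w x (c *: h) = c * dirgrad w x h.
Proof. by rewrite -[c *: h]addr0 dirgradD dirgrad0 addr0. Qed.

Lemma hessianZ x (c : R) h k : hessian w x h (c *: k) = c * hessian w x h k.
Proof.
rewrite /hessian mulr_sumr; apply: eq_bigr => i _.
rewrite mulrCA; congr (_ * _).
by rewrite /dirgrad mulr_sumr; apply: eq_bigr => j _; rewrite mxE mulrA.
Qed.

Lemma is_derive_w_t t p : U (pt t p) ->
  is_derive t (1 : R) (fun s => w (pt s p)) (flux_t t p).
Proof.
move=> Up; apply: (chain_rule (c := pt^~ p) oU Cu.1 Up) => i.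
exact: is_derive_pt_t.
Qed.

Lemma is_derive_w_p t p : U (pt t p) ->
  is_derive p (1 : R) (fun s => w (pt t s)) (sin t * flux_p t p).
Proof.
move=> Up; rewrite -dirgradZ; apply: (chain_rule oU Cu.1 Up) => i.
exact: is_derive_pt_p.
Qed.

(** The acceleration of a meridian is radial, and w has no radial derivative. *)
Lemma is_derive_flux_t t p : U (pt t p) ->
  is_derive t (1 : R) (fun s => sin s * flux_t s p) (lap_t t p).
Proof.
move=> Up.
have H := is_derive_dirgrad (c := pt^~ p) (v := pt_t^~ p) oU Cu Up
  (is_derive_pt_t t p) (is_derive_pt_tt t p).
have := is_derive_funM (is_derive_sin t) H.
rewrite dirgradZ (radial_ext_radial oU Cu.1 Up) mulr0 addr0 addrC.
by rewrite [_ * cos t]mulrC.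
Qed.

(** The acceleration of a parallel has, besides its radial part, the component
    - cos t along the meridian. *)
Lemma is_derive_flux_p t p : U (pt t p) ->
  is_derive p (1 : R) (fun s => flux_p t s) (lap_p t p).
Proof.
move=> Up; apply: is_derive_eq.
  exact: (is_derive_dirgrad (c := pt t) (v := pt_p) oU Cu Up
    (is_derive_pt_p t p) (is_derive_pt_pp t p)).
rewrite dirgradD dirgradZ (radial_ext_radial oU Cu.1 Up) mulr0 add0r.
by rewrite hessianZ mulNr.
Qed.

(** The terms cos t * flux_t cancel; what remains is sin t times the trace of the
    Hessian in the frame pt, pt_t, pt_p, whose radial entry is zero. *)
Lemma lap_tp t p : U (pt t p) ->
  lap_t t p + lap_p t p = sin t * laplace_beltrami u (pt t p).
Proof.
move=> Up; rewrite /laplace_beltrami -(hessian_frame _ _ (pt_orthoframe t p)).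
by rewrite (radial_ext_radial2 oU Cu Up) /lap_t /lap_p; ring.
Qed.

End SphericalCoordinates.

(** * Integration over a rectangle *)

Lemma integral_is_derive (R : realType) (F f : R -> R) (a b : R) : a < b ->
  (forall x, a <= x <= b -> is_derive x (1 : R) F (f x)) ->
  (forall x, a <= x <= b -> {for x, continuous f}) ->
  (\int[lebesgue_measure]_(x in `[a, b]) (f x)%:E = (F b)%:E - (F a)%:E)%E.
Proof.
move=> ab dF cf.
have cF x : a <= x <= b -> {for x, continuous F}.
  by move=> xab; apply: differentiable_continuous; apply/derivable1_diffP; case: (dF x xab).
apply: continuous_FTC2 => //.
- by apply: continuous_in_subspaceT => x /set_mem; rewrite /= in_itv/=; exact: cf.
- split.
  + by move=> x; rewrite in_itv/= => /andP[ax xb]; case: (dF x _) => //; rewrite !ltW.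
  + by apply: cvg_at_right_filter; apply: cF; rewrite lexx ltW.
  + by apply: cvg_at_left_filter; apply: cF; rewrite lexx ltW.
- move=> x; rewrite in_itv/= => /andP[ax xb].
  by rewrite derive1E; case: (dF x) => //; rewrite !ltW.
Qed.

Section RectangleIntegral.
Context {R : realType} (a b c d : R).
Hypotheses (ab : a < b) (cd : c < d).
Implicit Types f g : R * R -> R.

Notation mu := (@lebesgue_measure R).

Definition rect : set (R * R) := `[a, b]%classic `*` `[c, d]%classic.

(** Continuity is that of the plane, also at the edges: then the restrictions to
    horizontal and vertical segments are two-sided continuous at the end points. *)
Definition cont_rect f := forall z, rect z -> {for z, continuous f}.

Definition rectangle_measure : {measure set (measurableTypeR R * measurableTypeR R) -> \bar R} :=
  (mu \x mu)%E.

Definition rint f : R := \int[rectangle_measure]_(z in rect) f z.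

Lemma measurable_rect : measurable (rect : set (measurableTypeR R * measurableTypeR R)).
Proof. by apply: measurableX; exact: measurable_itv. Qed.

Lemma compact_rect : compact rect.
Proof. by apply: compact_setX; exact: segment_compact. Qed.

(** An open set of the plane is a countable union of squares with rational centres
    and radii 1 / (k + 1), and squares are measurable for the product
    sigma-algebra. *)
Lemma cont_rect_measurable f : cont_rect f ->
  measurable_fun (rect : set (measurableTypeR R * measurableTypeR R)) f.
Proof.
move=> cf; apply: (measurability _ (measurable_realfun.RGenOpens.measurableE R)).
move=> _ [_ [l [r ->] <-]].
set V := (X in f @^-1` X).
have oV : open V by exact: interval_open.
pose B (i : rat * rat * nat) : set (R * R) :=
  ball (ratr i.1.1 : R) (i.2.+1%:R^-1) `*` ball (ratr i.1.2 : R) (i.2.+1%:R^-1).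
pose G i := if `[< rect `&` B i `<=` f @^-1` V >] then B i else set0.
have -> : rect `&` f @^-1` V = rect `&` \bigcup_i G i.
  apply/seteqP; split => [z [Qz Vz]|z [Qz [i _]]]; last first.
    by rewrite /G; case: ifPn => // /asboolP sub Biz; split => //; apply: sub.
  split => //.
  have /cf/(_ V)/= : rect z by [].
  move=> /(_ (open_nbhs_nbhs (conj oV Vz))) /nbhs_ballP[e /= e0 He].
  have [k ke] : exists k : nat, 0 + k.+1%:R^-1 < e / 2.
    by apply: ltr_add_invr; rewrite divr_gt0.
  set s := k.+1%:R^-1 in ke; have s0 : (0 : R) < s by rewrite invr_gt0.
  have approx (x : R) : exists q : rat, `|ratr q - x| < s.
    have [|q] := @rat_in_itvoo R (x - s) (x + s); first by lra.
    by rewrite in_itv/= => qx; exists q; rewrite ltr_norml; lra.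
  have [[p Hp] [q Hq]] := (approx z.1, approx z.2).
  exists (p, q, k) => //; rewrite /G; case: ifPn => [_|/asboolP[]].
    by split; rewrite -ball_normE.
  move=> y [_]; rewrite /B -!ball_normE => -[/=] y1 y2.
  apply: He; split; rewrite -ball_normE/=.
  - have -> : z.1 - y.1 = (z.1 - ratr p) + (ratr p - y.1) by ring.
    by rewrite (le_lt_trans (ler_normD _ _))// distrC; move: Hp y1; rewrite -/s; lra.
  - have -> : z.2 - y.2 = (z.2 - ratr q) + (ratr q - y.2) by ring.
    by rewrite (le_lt_trans (ler_normD _ _))// distrC; move: Hq y2; rewrite -/s; lra.
apply: measurableI; first exact: measurable_rect.
apply: countable_bigcupT_measurable => // i; rewrite /G; case: ifP => _ //.
by apply: measurableX; rewrite ball_itv; exact: measurable_itv.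
Qed.

Lemma rectangle_measureE (p q r s : R) : rectangle_measure (`[p, q]%classic `*` `[r, s]%classic)
  = (mu `[p, q]%classic * mu `[r, s]%classic)%E.
Proof. by apply: product_measure1E; exact: measurable_itv. Qed.

Lemma rect_measure_fin : (rectangle_measure rect < +oo)%E.
Proof.
by rewrite rectangle_measureE !lebesgue_measure_itv/= !lte_fin ab cd -!EFinD -EFinM ltry.
Qed.

Lemma cont_rect_bounded f : cont_rect f -> exists2 M : R, 0 < M & forall z, rect z -> `|f z| <= M.
Proof.
move=> cf.
have /compact_bounded[M [_ HM]] : compact (f @` rect).
  apply: continuous_compact; last exact: compact_rect.
  by apply: continuous_in_subspaceT => z /set_mem; exact: cf.
exists (`|M| + 1) => [|z Qz]; first by rewrite ltr_pwDr.
apply: (HM (`|M| + 1)); last by exists z.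
by rewrite (le_lt_trans (ler_norm M))// ltrDl.
Qed.

Lemma cont_rect_integrable f : cont_rect f ->
  rectangle_measure.-integrable rect (EFin \o f).
Proof.
move=> cf; apply: measurable_bounded_integrable.
- exact: measurable_rect.
- exact: rect_measure_fin.
- exact: cont_rect_measurable.
- have [M M0 HM] := cont_rect_bounded cf.
  by exists M; split; rewrite ?num_real // => x Mx y Qy; apply: (le_trans (HM y Qy)); exact: ltW.
Qed.

Lemma rintD f g : cont_rect f -> cont_rect g ->
  rint (fun z => f z + g z) = rint f + rint g.
Proof.
by move=> cf cg; apply: RintegralD; [exact: measurable_rect|exact: cont_rect_integrable..].
Qed.

Lemma rintZ (k : R) f : cont_rect f -> rint (fun z => k * f z) = k * rint f.
Proof.
by move=> cf; apply: RintegralZl; [exact: measurable_rect|exact: cont_rect_integrable].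
Qed.

Lemma eq_rint f g : (forall z, rect z -> f z = g z) -> rint f = rint g.
Proof. by move=> fg; apply: eq_Rintegral => z /set_mem; exact: fg. Qed.

Lemma le_rint f g : cont_rect f -> cont_rect g -> (forall z, rect z -> f z <= g z) ->
  rint f <= rint g.
Proof.
by move=> cf cg fg; apply: le_Rintegral; [exact: measurable_rect|exact: cont_rect_integrable..|].
Qed.

Lemma rint_fubini f : cont_rect f ->
  (rint f)%:E = (\int[mu]_(x in `[a, b]) \int[mu]_(y in `[c, d]) (f (x, y))%:E)%E /\
  (rint f)%:E = (\int[mu]_(y in `[c, d]) \int[mu]_(x in `[a, b]) (f (x, y))%:E)%E.
Proof.
move=> cf; have fi := cont_rect_integrable cf.
have mR := measurable_rect.
have Ef : (rint f)%:E = (\int[rectangle_measure]_z ((EFin \o f) \_ rect) z)%E.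
  by rewrite -integral_mkcond /rint /Rintegral fineK//; exact: integrable_fin_num fi.
have ri : (mu \x mu)%E.-integrable setT ((EFin \o f) \_ rect).
  by apply/(integrable_mkcond _ mR).
split.
- rewrite Ef -(integral12_prod_meas1 ri) [RHS]integral_mkcond.
  apply: eq_integral => x _; rewrite patchE; case: ifPn => [/set_mem xab|/negP xab].
    rewrite [RHS]integral_mkcond; apply: eq_integral => y _.
    rewrite !patchE; case: ifPn => [/set_mem[]//= _ ycd|/negP xyQ]; first by rewrite mem_set.
    case: ifPn => // /set_mem ycd; exfalso; apply: xyQ; exact/mem_set.
  apply: integral0_eq => y _; rewrite patchE; case: ifPn => // /set_mem[/= xab' _].
  by exfalso; apply: xab; exact/mem_set.
- rewrite Ef -(integral21_prod_meas1 ri) [RHS]integral_mkcond.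
  apply: eq_integral => y _; rewrite patchE; case: ifPn => [/set_mem ycd|/negP ycd].
    rewrite [RHS]integral_mkcond; apply: eq_integral => x _.
    rewrite !patchE; case: ifPn => [/set_mem[]//= xab _|/negP xyQ]; first by rewrite mem_set.
    case: ifPn => // /set_mem xab; exfalso; apply: xyQ; exact/mem_set.
  apply: integral0_eq => x _; rewrite patchE; case: ifPn => // /set_mem[/= _ ycd'].
  by exfalso; apply: ycd; exact/mem_set.
Qed.

Lemma cont_rect_slice1 f y : cont_rect f -> c <= y <= d ->
  forall x, a <= x <= b -> {for x, continuous (fun x => f (x, y))}.
Proof.
move=> cf ycd x xab.
apply: (@continuous_comp _ _ _ (fun x => (x, y)) f); last first.
  by apply: cf; split; rewrite /= in_itv.
exact: (cvg_pair (@cvg_id _ (nbhs x)) (cvg_cst y)).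

Qed.

Lemma cont_rect_slice2 f x : cont_rect f -> a <= x <= b ->
  forall y, c <= y <= d -> {for y, continuous (fun y => f (x, y))}.
Proof.
move=> cf xab y ycd.
apply: (@continuous_comp _ _ _ (fun y => (x, y)) f); last first.
  by apply: cf; split; rewrite /= in_itv.
exact: (cvg_pair (cvg_cst x) (@cvg_id _ (nbhs y))).

Qed.

(** Integrating first in the variable of the derivative leaves the difference of
    the end values, which is zero on every line. *)
Lemma rint_derive1 f (F : R -> R -> R) : cont_rect f ->
  (forall x y, rect (x, y) -> is_derive x (1 : R) (fun s => F s y) (f (x, y))) ->
  (forall y, c <= y <= d -> F a y = F b y) -> rint f = 0.
Proof.
move=> cf dF Fab; apply: EFin_inj; have [_ ->] := rint_fubini cf.
apply: integral0_eq => y /=; rewrite in_itv/= => ycd.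
have dFy x : a <= x <= b -> is_derive x (1 : R) (fun s => F s y) (f (x, y)).
  by move=> xab; apply: dF; split; rewrite /= in_itv.
by rewrite (integral_is_derive ab dFy (cont_rect_slice1 cf ycd)) Fab// -EFinB subrr.
Qed.

Lemma rint_derive2 f (F : R -> R -> R) : cont_rect f ->
  (forall x y, rect (x, y) -> is_derive y (1 : R) (fun s => F x s) (f (x, y))) ->
  (forall x, a <= x <= b -> F x c = F x d) -> rint f = 0.
Proof.
move=> cf dF Fcd; apply: EFin_inj; have [-> _] := rint_fubini cf.
apply: integral0_eq => x /=; rewrite in_itv/= => xab.
have dFx y : c <= y <= d -> is_derive y (1 : R) (fun s => F x s) (f (x, y)).
  by move=> ycd; apply: dF; split; rewrite /= in_itv.
by rewrite (integral_is_derive cd dFx (cont_rect_slice2 cf xab)) Fcd// -EFinB subrr.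
Qed.

(** By continuity f exceeds half of its value at z on a small square around z,
    and the part of this square inside the rectangle has positive area, even when
    z lies on an edge. *)
Lemma rint_gt0 f z : cont_rect f -> (forall y, rect y -> 0 <= f y) ->
  rect z -> 0 < f z -> 0 < rint f.
Proof.
move=> cf f0 Qz fz.
have fz2 : 0 < f z / 2 by rewrite divr_gt0.
have /cvgrPdist_lt/(_ _ fz2)/nbhs_ballP[e /= e0 He] := cf z Qz.
pose a' := Num.max a (z.1 - e / 2); pose b' := Num.min b (z.1 + e / 2).
pose c' := Num.max c (z.2 - e / 2); pose d' := Num.min d (z.2 + e / 2).
have [/=] := Qz; rewrite !in_itv/= => /andP[az bz] /andP[cz dz].
have ab' : a' < b' by rewrite /a' /b' lt_min !gt_max ab /=; lra.
have cd' : c' < d' by rewrite /c' /d' lt_min !gt_max cd /=; lra.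
pose S : set (R * R) := `[a', b']%classic `*` `[c', d']%classic.
have SQ y : S y -> rect y /\ f z / 2 <= f y.
  move=> [/=]; rewrite !in_itv/= /a' /b' /c' /d' !ge_max !le_min.
  move=> /andP[/andP[y1 y2] /andP[y3 y4]] /andP[/andP[y5 y6] /andP[y7 y8]].
  split; first by split; rewrite /= in_itv/= ?y1 ?y3 ?y5 ?y7.
  have /He : ball z e y by split; rewrite -ball_normE/= ltr_norml; lra.
  by rewrite /= ltr_norml; lra.
have mS : measurable (S : set (measurableTypeR R * measurableTypeR R)).
  by apply: measurableX; exact: measurable_itv.
have mQ := measurable_rect.
have mf := cont_rect_measurable cf.
have muS : rectangle_measure S = ((b' - a') * (d' - c'))%:E.
  by rewrite rectangle_measureE !lebesgue_measure_itv/= !lte_fin ab' cd' -!EFinD -EFinM.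
rewrite -lte_fin.
have -> : (rint f)%:E = (\int[rectangle_measure]_(z in rect) (f z)%:E)%E.
  by rewrite /rint /Rintegral fineK//; exact: integrable_fin_num (cont_rect_integrable cf).
apply: (@lt_le_trans _ _ (\int[rectangle_measure]_(y in S) (f z / 2)%:E)%E).
  rewrite integral_cst// muS lte_fin.
  by rewrite mulr_gt0// mulr_gt0// subr_gt0.
apply: (@le_trans _ _ (\int[rectangle_measure]_(y in S) (f y)%:E)%E).
  apply: ge0_le_integral => //.
  - by move=> y Sy; rewrite lee_fin ltW.
  - by apply/measurable_realfun.measurable_EFinP; apply: measurable_funS mf => // y /SQ[].
  - by move=> y Sy; rewrite lee_fin; case: (SQ y Sy).
apply: ge0_subset_integral => //.
- exact/measurable_realfun.measurable_EFinP.
- by move=> y /SQ[].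
Qed.

End RectangleIntegral.

(** * Green's formula on the hemisphere *)

Section ContinuousOnRectangles.
Context {R : realType} (a b c d : R).
Notation cont := (cont_rect a b c d).
Implicit Types f g : R * R -> R.

Lemma cont_rectD f g : cont f -> cont g -> cont (fun z => f z + g z).
Proof. by move=> cf cg z Qz; apply: (@continuousD R _ _ f g z); [exact: cf|exact: cg]. Qed.

Lemma cont_rectM f g : cont f -> cont g -> cont (fun z => f z * g z).
Proof. by move=> cf cg z Qz; apply: (@continuousM R _ f g z); [exact: cf|exact: cg]. Qed.

Lemma cont_rectN f : cont f -> cont (fun z => - f z).
Proof. by move=> cf z Qz; apply: (@continuousN R _ _ f z); exact: cf. Qed.

Lemma cont_rectB f g : cont f -> cont g -> cont (fun z => f z - g z).
Proof. by move=> cf cg; apply: cont_rectD => //; exact: cont_rectN. Qed.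

Lemma cont_rect_cst (k : R) : cont (fun=> k).
Proof. by move=> z _; exact: cst_continuous. Qed.

Lemma cont_rect_sum n (h : 'I_n -> R * R -> R) : (forall i, cont (h i)) ->
  cont (fun z => \sum_(i < n) h i z).
Proof.
move=> ch; elim: n h ch => [|n IH] h ch.
  rewrite (_ : (fun z => _) = (fun=> 0)); first exact: cont_rect_cst.
  by apply/funext => z; rewrite big_ord0.
rewrite (_ : (fun z => _) = (fun z => h ord0 z + \sum_(i < n) h (lift ord0 i) z)).
  by apply: cont_rectD => //; apply: IH => i.
by apply/funext => z; rewrite big_ord_recl.
Qed.

Lemma cont_rect_fst (g : R -> R) : continuous g -> cont (fun z => g z.1).
Proof. by move=> cg z _; apply: (@continuous_comp _ _ _ fst g); [exact: cvg_fst|exact: cg]. Qed.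

Lemma cont_rect_snd (g : R -> R) : continuous g -> cont (fun z => g z.2).
Proof. by move=> cg z _; apply: (@continuous_comp _ _ _ snd g); [exact: cvg_snd|exact: cg]. Qed.

(** The vertical edges lie in the closure of the open strip. *)
Lemma cont_rect_eq0 f : a < b -> cont f ->
  (forall z, rect a b c d z -> a < z.1 < b -> f z = 0) ->
  forall z, rect a b c d z -> f z = 0.
Proof.
move=> ab cf f0 z Qz; apply/eqP; case: eqVneq => // fz0; exfalso.
have fz : 0 < `|f z| by rewrite normr_gt0.
have /cvgrPdist_lt/(_ _ fz)/nbhs_ballP[e /= e0 He] := cf z Qz.
have [/=] := Qz; rewrite !in_itv/= => /andP[az bz] /andP[cz dz].
pose l := Num.max a (z.1 - e); pose r := Num.min b (z.1 + e).
have lr : l < r.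
  have h1 : a < z.1 + e by rewrite (le_lt_trans az)// ltrDl.
  have h2 : z.1 - e < b by rewrite (lt_le_trans _ bz)// ltrBlDr ltrDl.
  have h3 : z.1 - e < z.1 + e by rewrite ltrBlDr -addrA ltrDl addr_gt0.
  by rewrite /l /r gt_max !lt_min ab h1 h2 h3.
pose y : R * R := ((l + r) / 2, z.2).
have /andP[ly yr] : l < y.1 < r by rewrite /y/= midf_lt ?midf_lt.
have /andP[ay zy] : (a < y.1) && (z.1 - e < y.1) by rewrite -gt_max.
have /andP[yb yz] : (y.1 < b) && (y.1 < z.1 + e) by rewrite -lt_min.
have Qy : rect a b c d y by split; rewrite /= in_itv/= ?cz ?dz// !ltW.
have y2 : z.2 = y.2 by [].
clearbody y.
have : ball z e y.
  by split; rewrite -ball_normE/= -?y2 ?subrr ?normr0// ltr_norml; lra.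
by move=> /He /=; rewrite (f0 y Qy) ?subr0 ?ltxx// ay.
Qed.

End ContinuousOnRectangles.

(** In Green's formula P and Q are the fluxes of p and q up to a common factor, so
    the products of first derivatives cancel. *)
Lemma is_derive_wronskian (R : realType) (p P q Q : R -> R) (t dp dP dq dQ : R) :
  is_derive t (1 : R) p dp -> is_derive t (1 : R) P dP ->
  is_derive t (1 : R) q dq -> is_derive t (1 : R) Q dQ -> P t * dp = Q t * dq ->
  is_derive t (1 : R) (fun s => p s * P s - q s * Q s) (p t * dP - q t * dQ).
Proof.
move=> hp hP hq hQ E.
apply: (is_derive_eq (is_derive_funB (is_derive_funM hp hP) (is_derive_funM hq hQ))).
by rewrite E; ring.
Qed.

Section HemisphereIntegral.
Context {R : realType} (a b n : 'rV[R]_3).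
Hypothesis F : orthoframe a b n.
Notation pt := (pt a b n).
Notation pt_t := (pt_t a b n).
Notation pt_p := (pt_p a b n).
Notation Q := (rect 0 (pi / 2) 0 (2 * pi)).
Notation cont := (cont_rect 0 (pi / 2) 0 (2 * pi)).
Implicit Types (f g u v : 'rV[R]_3 -> R).

Lemma pihalf_gt0 : 0 < pi / 2 :> R.
Proof. by rewrite divr_gt0// pi_gt0. Qed.

Lemma twopi_gt0 : 0 < 2 * pi :> R.
Proof. by rewrite mulr_gt0// pi_gt0. Qed.

Definition hcont f := cont (fun z => f (pt z.1 z.2)).
(** The integral over the hemisphere; sin t dt dp is the area element. *)
Definition hint f := rint 0 (pi / 2) 0 (2 * pi) (fun z => sin z.1 * f (pt z.1 z.2)).

Lemma hcontM f g : hcont f -> hcont g -> hcont (fun x => f x * g x).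
Proof. exact: cont_rectM. Qed.

Lemma hcontZ k f : hcont f -> hcont (fun x => k * f x).
Proof. by move=> cf; apply: cont_rectM => //; exact: cont_rect_cst. Qed.

Lemma hcont_sin f : hcont f -> cont (fun z => sin z.1 * f (pt z.1 z.2)).
Proof. by move=> cf; apply: cont_rectM => //; apply: cont_rect_fst; exact: continuous_sin. Qed.

Lemma hintD f g : hcont f -> hcont g -> hint (fun x => f x + g x) = hint f + hint g.
Proof.
move=> cf cg; rewrite -rintD//;
  [|exact: pihalf_gt0|exact: twopi_gt0|exact: hcont_sin|exact: hcont_sin].
by apply: eq_rint => z _; rewrite mulrDr.
Qed.

Lemma hintZ k f : hcont f -> hint (fun x => k * f x) = k * hint f.
Proof.
move=> cf; rewrite -rintZ//; [|exact: pihalf_gt0|exact: twopi_gt0|exact: hcont_sin].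
by apply: eq_rint => z _; rewrite mulrCA.
Qed.

Lemma hint_eq f g : hcont f -> hcont g -> hint (fun x => f x + -1 * g x) = 0 ->
  hint f = hint g.
Proof.
move=> cf cg; rewrite (hintD cf (hcontZ (k := -1) cg)) (hintZ (-1) cg) mulN1r.
by move/eqP; rewrite subr_eq0 => /eqP.
Qed.

Lemma hemisphere_pt z : Q z -> hemisphere n (pt z.1 z.2).
Proof.
move=> [/=]; rewrite !in_itv/= => /andP[t0 tpi] _; split.
  by apply/sphere2P; exact: dot_pt F _ _.
by rewrite (dot_comb_n F); apply: cos_ge0_pihalf;
  rewrite tpi andbT (le_trans _ t0)// oppr_le0 ltW// pihalf_gt0.
Qed.

Lemma hemisphere_interior_pt z : Q z -> z.1 < pi / 2 -> hemisphere_interior n (pt z.1 z.2).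
Proof.
move=> [/=]; rewrite !in_itv/= => /andP[t0 _] _ tpi; split.
  by apply/sphere2P; exact: dot_pt F _ _.
by rewrite (dot_comb_n F); apply: cos_gt0_pihalf;
  rewrite tpi andbT (lt_le_trans _ t0)// oppr_lt0 pihalf_gt0.
Qed.

Lemma hemisphere_boundary_pt p : hemisphere_boundary n (pt (pi / 2) p).
Proof.
split; first by apply/sphere2P; exact: dot_pt F _ _.
by rewrite (dot_comb_n F) cos_pihalf.
Qed.

Lemma comb_continuous (f g h : R * R -> R) (z : R * R) :
  {for z, continuous f} -> {for z, continuous g} -> {for z, continuous h} ->
  {for z, continuous (fun z => comb a b n (f z) (g z) (h z))}.
Proof.
move=> cf cg ch; rewrite /comb.
by apply: cvgD; [apply: cvgD|]; apply: cvgZr_tmp.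
Qed.

Lemma pt_continuous z : {for z, continuous (fun z => pt z.1 z.2)}.
Proof.
have C (k : R * R -> R) : (forall a b c d, cont_rect a b c d k) -> {for z, continuous k}.
  by move=> /(_ z.1 z.1 z.2 z.2)/(_ z); apply; split; rewrite /= in_itv/= lexx.
apply: comb_continuous; apply: C => *.
- by apply: cont_rectM; [apply: cont_rect_fst; exact: continuous_sin|apply: cont_rect_snd;
  exact: continuous_cos].
- by apply: cont_rectM; [apply: cont_rect_fst; exact: continuous_sin|apply: cont_rect_snd;
  exact: continuous_sin].
- by apply: cont_rect_fst; exact: continuous_cos.
Qed.

Lemma hcont_of_continuous f : (forall x, hemisphere n x -> {for x, continuous f}) -> hcont f.
Proof.
move=> cf z Qz; apply: (@continuous_comp _ _ _ (fun z => pt z.1 z.2) f).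
  exact: pt_continuous.
by apply: cf; exact: hemisphere_pt.
Qed.

Lemma radial_ext_pt u t p : radial_ext u (pt t p) = u (pt t p).
Proof. by apply: radial_ext_sphere; exact: dot_pt F _ _. Qed.

Lemma hcont_radial_ext u : hcont (radial_ext u) = hcont u.
Proof. by congr cont; apply/funext => z; rewrite radial_ext_pt. Qed.

Section Regular.
Variables (U : set 'rV[R]_3) (u : 'rV[R]_3 -> R).
Hypotheses (oU : open U) (HU : hemisphere n `<=` U) (Cu : C2_on U (radial_ext u)).
Let w := radial_ext u.

Lemma hcont_C2 : hcont w.
Proof. by apply: hcont_of_continuous => x Hx; apply: C1_on_continuous Cu.1 (HU Hx). Qed.

Lemma hcont_partial i : hcont (partial i w).
Proof. by apply: hcont_of_continuous => x Hx; case: (Cu.1 i x (HU Hx)). Qed.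

Lemma hcont_partial2 i j : hcont (partial j (partial i w)).
Proof. by apply: hcont_of_continuous => x Hx; case: (Cu.2 i j x (HU Hx)). Qed.

Lemma hcont_laplace_beltrami : hcont (laplace_beltrami u).
Proof. by apply: cont_rect_sum => i; exact: hcont_partial2. Qed.

Lemma cont_comb_coord (f g h : R * R -> R) i : cont f -> cont g -> cont h ->
  cont (fun z => comb a b n (f z) (g z) (h z) 0 i).
Proof.
move=> cf cg ch.
rewrite (_ : (fun z => _) = (fun z => f z * a 0 i + g z * b 0 i + h z * n 0 i)).
  by do 2?apply: cont_rectD; apply: cont_rectM => //; exact: cont_rect_cst.
by apply/funext => z; rewrite !mxE.
Qed.

Lemma cont_pt_t i : cont (fun z => pt_t z.1 z.2 0 i).
Proof.
apply: cont_comb_coord.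
- by apply: cont_rectM; [apply: cont_rect_fst|apply: cont_rect_snd]; exact: continuous_cos.
- by apply: cont_rectM; [apply: cont_rect_fst; exact: continuous_cos|apply: cont_rect_snd;
  exact: continuous_sin].
- by apply: cont_rectN; apply: cont_rect_fst; exact: continuous_sin.
Qed.

Lemma cont_pt_p i : cont (fun z => pt_p z.2 0 i).
Proof.
apply: cont_comb_coord; last exact: cont_rect_cst.
- by apply: cont_rectN; apply: cont_rect_snd; exact: continuous_sin.
- by apply: cont_rect_snd; exact: continuous_cos.
Qed.

Lemma cont_flux_t : cont (fun z => flux_t a b n u z.1 z.2).
Proof. by apply: cont_rect_sum => i; apply: cont_rectM;
  [exact: cont_pt_t|exact: hcont_partial]. Qed.

Lemma cont_hessian (h : R * R -> 'rV[R]_3) : (forall i, cont (fun z => h z 0 i)) ->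
  cont (fun z => hessian w (pt z.1 z.2) (h z) (h z)).
Proof.
move=> ch; apply: cont_rect_sum => i; apply: cont_rectM; first exact: ch.
by apply: cont_rect_sum => j; apply: cont_rectM; [exact: ch|exact: hcont_partial2].
Qed.

Lemma cont_lap_t : cont (fun z => lap_t a b n u z.1 z.2).
Proof.
apply: cont_rectD; apply: cont_rectM.
- by apply: cont_rect_fst; exact: continuous_cos.
- exact: cont_flux_t.
- by apply: cont_rect_fst; exact: continuous_sin.
- by apply: cont_hessian; exact: cont_pt_t.
Qed.

Lemma cont_lap_p : cont (fun z => lap_p a b n u z.1 z.2).
Proof.
apply: cont_rectB; apply: cont_rectM.
- by apply: cont_rect_fst; exact: continuous_sin.
- by apply: cont_hessian; exact: cont_pt_p.
- by apply: cont_rect_fst; exact: continuous_cos.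
- exact: cont_flux_t.
Qed.

(** At the boundary pt_t is the outward conormal, so both conditions become
    conditions on the meridian. *)
Lemma bc_pihalf bc p : satisfies_bc bc n u ->
  match bc with
  | Neumann => flux_t a b n u (pi / 2) p = 0
  | Dirichlet => w (pt (pi / 2) p) = 0
  end.
Proof.
move=> /(_ (pt (pi / 2) p) (hemisphere_boundary_pt p)); case: bc => [|<-];
  last exact: radial_ext_pt.
rewrite (C1_on_derive _ oU Cu.1) => [<-|]; first by rewrite /flux_t pt_t_pihalf.
apply: HU; have [H1 H2] := hemisphere_boundary_pt p.
by split => //; rewrite H2.
Qed.

End Regular.

(** v Delta u - u Delta v is the divergence of v grad u - u grad v.  Its part in t
    integrates to a difference of end values, which vanishes at the pole because
    of the factor sin t and at the equator because of the boundary condition; its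
    part in p integrates to zero because longitudes 0 and 2 pi coincide. *)
Lemma green_hemisphere bc u v : C2_hemisphere n u -> C2_hemisphere n v ->
  satisfies_bc bc n u -> satisfies_bc bc n v ->
  hint (fun x => v x * laplace_beltrami u x) = hint (fun x => u x * laplace_beltrami v x).
Proof.
move=> [U [oU HU Cu]] [V [oV HV Cv]] bu bv.
have [p0 t0] := (pihalf_gt0, twopi_gt0).
have cu := hcont_C2 oU HU Cu; have cv := hcont_C2 oV HV Cv.
have cLu := hcont_laplace_beltrami HU Cu; have cLv := hcont_laplace_beltrami HV Cv.
pose wu := radial_ext u; pose wv := radial_ext v.
pose fA z := wv (pt z.1 z.2) * lap_t a b n u z.1 z.2 - wu (pt z.1 z.2) * lap_t a b n v z.1 z.2.
pose fB z := wv (pt z.1 z.2) * lap_p a b n u z.1 z.2 - wu (pt z.1 z.2) * lap_p a b n v z.1 z.2.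
have cA : cont fA by apply: cont_rectB; apply: cont_rectM => //;
  [exact: cont_lap_t HU Cu|exact: cont_lap_t HV Cv].
have cB : cont fB by apply: cont_rectB; apply: cont_rectM => //;
  [exact: cont_lap_p HU Cu|exact: cont_lap_p HV Cv].
have dA t p : Q (t, p) -> is_derive t (1 : R)
    (fun t => wv (pt t p) * (sin t * flux_t a b n u t p)
      - wu (pt t p) * (sin t * flux_t a b n v t p)) (fA (t, p)).
  move=> /hemisphere_pt/= Hx.
  apply: (is_derive_wronskian (is_derive_w_t oV Cv (HV _ Hx)) (is_derive_flux_t oU Cu (HU _ Hx))
    (is_derive_w_t oU Cu (HU _ Hx)) (is_derive_flux_t oV Cv (HV _ Hx))).
  by rewrite mulrAC.
have dB t p : Q (t, p) -> is_derive p (1 : R)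
    (fun p => wv (pt t p) * flux_p a b n u t p - wu (pt t p) * flux_p a b n v t p) (fB (t, p)).
  move=> /hemisphere_pt/= Hx.
  apply: (is_derive_wronskian (is_derive_w_p oV Cv (HV _ Hx)) (is_derive_flux_p oU Cu (HU _ Hx))
    (is_derive_w_p oU Cu (HU _ Hx)) (is_derive_flux_p oV Cv (HV _ Hx))).
  by rewrite mulrCA [RHS]mulrCA [X in _ * X]mulrC.
have A0 : rint 0 (pi / 2) 0 (2 * pi) fA = 0.
  apply: (rint_derive1 p0 t0 cA dA) => p _; rewrite sin0 !mul0r !mulr0 subrr.
  have := bc_pihalf oU HU Cu p bu; have := bc_pihalf oV HV Cv p bv.
  rewrite -/wu -/wv.
  by case: bc {bu bv} => -> ->; rewrite ?mulr0 ?mul0r subrr.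
have B0 : rint 0 (pi / 2) 0 (2 * pi) fB = 0.
  by apply: (rint_derive2 p0 t0 cB dB) => t _; rewrite /flux_p pt_2pi pt_p_2pi.
have cuL : hcont (fun x => u x * laplace_beltrami v x) by apply: hcontM => //;
  rewrite -hcont_radial_ext.
have cvL : hcont (fun x => v x * laplace_beltrami u x) by apply: hcontM => //;
  rewrite -hcont_radial_ext.
apply: (hint_eq cvL cuL).
have alg (p q s : R) (a1 a2 l b1 b2 m : R) : a1 + a2 = s * l -> b1 + b2 = s * m ->
    p * a1 - q * b1 + (p * a2 - q * b2) = s * (p * l + -1 * (q * m)).
  move=> Ea Eb; transitivity (p * (a1 + a2) - q * (b1 + b2)); first by ring.
  by rewrite Ea Eb; ring.
transitivity (rint 0 (pi / 2) 0 (2 * pi) (fun z => fA z + fB z)).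
  apply: eq_rint => -[t p] /hemisphere_pt/= Hx; rewrite /fA /fB/= /wu /wv !radial_ext_pt.
  exact/esym/(alg _ _ _ _ _ _ _ _ _ (lap_tp F oU Cu (HU _ Hx)) (lap_tp F oV Cv (HV _ Hx))).
by rewrite rintD// A0 B0 addr0.
Qed.

End HemisphereIntegral.

(** * Monomials on the sphere *)

Section Monomials.
Context {R : realType}.
Implicit Types (x y v : 'rV[R]_3).

Lemma is_derive_coord x v l : is_derive x v (fun y => y 0 l) (v 0 l).
Proof.
apply: is_derive_of_line.
rewrite (_ : (fun r => _) = (fun r : R => x 0 l + r * v 0 l)); last first.
  by apply/funext => r; rewrite !mxE.
have := is_derive_funD (is_derive_fun_cst (x 0 l) 0 (1 : R))
  (is_derive_cMr (v 0 l) (is_derive_id (0 : R) (1 : R))).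
by rewrite mul1r add0r.
Qed.

Lemma is_derive_dot x v y : is_derive x v (fun z => dot z y) (dot v y).
Proof.
apply: is_derive_funS => i; have := is_derive_funM (is_derive_coord x v i)
  (is_derive_fun_cst (y 0 i) x v).
by rewrite mulr0 add0r mulrC.
Qed.

Lemma is_derive_dot_self x v : is_derive x v (fun z => dot z z) (2 * dot x v).
Proof.
rewrite /dot mulr_sumr; apply: is_derive_funS => i.
have := is_derive_funM (is_derive_coord x v i) (is_derive_coord x v i).
by rewrite -mulr2n mulr_natl.
Qed.

Lemma enorm_gt0 x : 0 < dot x x -> 0 < enorm x.
Proof. by rewrite sqrtr_gt0. Qed.

Lemma is_derive_inv_enorm x v : 0 < dot x x ->
  is_derive x v (fun z => (enorm z)^-1) (- dot x v * (enorm x)^-1 ^+ 3).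
Proof.
move=> x0; have r0 := enorm_gt0 x0.
have dr := is_derive_fun_comp (f := fun z : 'rV[R]_3 => dot z z) (is_derive1_sqrt x0)
  (is_derive_dot_self x v).
have rn0 : enorm x != 0 by rewrite gt_eqF.
have di : is_derive (enorm x) 1 (fun t : R => t^-1) (- (enorm x) ^- 2 *: 1).
  exact: (@is_deriveV _ id).
apply: (is_derive_eq (@is_derive_fun_comp _ _ (fun t : R => t^-1) (@enorm R) _ _ _ _ di dr)).
rewrite [_ *: 1]mulr1 -[Num.sqrt _]/(enorm x); move: (enorm x) rn0 (dot x v) => r r0' q.
by field.
Qed.

Lemma dot_continuous y : continuous (fun z : 'rV[R]_3 => dot z y).
Proof.
apply: continuous_big => //; first exact: add_continuous.
move=> i _ z; apply: (@continuousM R _ (fun h : 'rV[R]_3 => h 0 i) (fun=> y 0 i) z).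
  exact: coord_rV3_continuous.
exact: cst_continuous.
Qed.

Lemma dot_self_continuous : continuous (fun z : 'rV[R]_3 => dot z z).
Proof.
apply: continuous_big => //; first exact: add_continuous.
move=> i _ z; apply: (@continuousM R _ (fun h : 'rV[R]_3 => h 0 i) (fun h => h 0 i) z);
  exact: coord_rV3_continuous.
Qed.

Lemma inv_enorm_continuous x : 0 < dot x x ->
  {for x, continuous (fun z : 'rV[R]_3 => (enorm z)^-1)}.
Proof.
move=> x0; apply: (@continuousV R _ (@enorm R) x); first by rewrite gt_eqF ?enorm_gt0.
apply: (@continuous_comp _ _ _ (fun z : 'rV[R]_3 => dot z z) Num.sqrt).
  exact: dot_self_continuous.
exact: sqrt_continuous.
Qed.

Definition punctured : set 'rV[R]_3 := [set x | 0 < dot x x].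

Lemma open_punctured : open punctured.
Proof.
have /continuousP := dot_self_continuous.
by move=> /(_ [set t | 0 < t] (@open_gt R 0)).
Qed.

Lemma hemisphere_punctured (n : 'rV[R]_3) : hemisphere n `<=` punctured.
Proof. by move=> x [/sphere2P x1 _]; rewrite /punctured/= x1. Qed.

Lemma C1_on_is_derive (U : set 'rV[R]_3) f (d : 'I_3 -> 'rV[R]_3 -> R) : open U ->
  (forall l x, U x -> is_derive x (delta_mx 0 l) f (d l x)) ->
  (forall l x, U x -> {for x, continuous (d l)}) -> C1_on U f.
Proof.
move=> oU df cd l x Ux; split; first by case: (df l x Ux).
have E : {near x, d l =1 partial l f}.
  near=> y; have Uy : U y by near: y; exact: open_nbhs_nbhs.
  by have [_ <-] := df l y Uy.
rewrite /prop_for /continuous_at -(nbhs_singleton E).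
exact: cvg_trans (near_eq_cvg E) (cd l x Ux).
Unshelve. all: by end_near. Qed.

Section ContinuityRules.
Variable V : topologicalType.
Implicit Types (f g : V -> R) (z : V).

Lemma continuous_funM f g z : {for z, continuous f} -> {for z, continuous g} ->
  {for z, continuous (fun z => f z * g z)}.
Proof. exact: continuousM. Qed.

Lemma continuous_funD f g z : {for z, continuous f} -> {for z, continuous g} ->
  {for z, continuous (fun z => f z + g z)}.
Proof. exact: continuousD. Qed.

Lemma continuous_funB f g z : {for z, continuous f} -> {for z, continuous g} ->
  {for z, continuous (fun z => f z - g z)}.
Proof. exact: continuousB. Qed.

Lemma continuous_funX f z k : {for z, continuous f} -> {for z, continuous (fun z => f z ^+ k)}.
Proof.
move=> cf; elim: k => [|k IH]; first exact: cst_continuous.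
rewrite (_ : (fun z => _) = (fun z => f z * f z ^+ k)); first exact: continuous_funM.
by apply/funext => y; rewrite exprS.
Qed.

End ContinuityRules.

Section Frame.
Variables a b n : 'rV[R]_3.
Hypothesis F : orthoframe a b n.

Definition mono i j s x : R := dot x a ^+ i * dot x b ^+ j * dot x n ^+ s.

(** For e = i + j + s this is the extension of the monomial that is constant along
    rays; the other exponents occur in its derivatives. *)
Definition hmono i j s e x : R := mono i j s x * (enorm x)^-1 ^+ e.

Lemma continuous_hmono i j s e x : punctured x -> {for x, continuous (hmono i j s e)}.
Proof.
move=> x0; apply: continuous_funM; last exact/continuous_funX/inv_enorm_continuous.
apply: continuous_funM; last exact/continuous_funX/dot_continuous.
by apply: continuous_funM; exact/continuous_funX/dot_continuous.
Qed.

(** The predecessors truncate at 0 only where the factor in front of them is 0.  The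
    derivative is again a combination of functions hmono, so that the same rule
    gives the second derivatives. *)
Definition d_hmono i j s e v x : R :=
  i%:R * dot v a * hmono i.-1 j s e x + j%:R * dot v b * hmono i j.-1 s e x
  + s%:R * dot v n * hmono i j s.-1 e x - e%:R * dot x v * hmono i j s e.+2 x.

Lemma is_derive_hmono i j s e x v : punctured x ->
  is_derive x v (hmono i j s e) (d_hmono i j s e v x).
Proof.
move=> x0.
have dX := is_derive_funX i (is_derive_dot x v a).
have dY := is_derive_funX j (is_derive_dot x v b).
have dZ := is_derive_funX s (is_derive_dot x v n).
have dr := is_derive_funX e (is_derive_inv_enorm v x0).
apply: (is_derive_eq (is_derive_funM (is_derive_funM (is_derive_funM dX dY) dZ) dr)).
rewrite /d_hmono /hmono /mono; move: (dot x a) (dot x b) (dot x n) (enorm x)^-1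
  (dot x v) => X Y Z r q.
have -> : e%:R * r ^+ e.-1 * (- q * r ^+ 3) = - (e%:R * q * r ^+ e.+2).
  by case: e {dr} => [|e]; [rewrite !mul0r oppr0|rewrite /= -(addn3 e) (exprD r e); ring].
by ring.
Qed.

Lemma dot_delta l y : dot (delta_mx 0 l) y = y 0 l.
Proof.
rewrite /dot (bigD1 l)//= big1 ?addr0 => [|i il]; first by rewrite mxE !eqxx mul1r.
by rewrite mxE eqxx (negbTE il) mul0r.
Qed.

Lemma continuous_d_hmono i j s e v x : punctured x ->
  {for x, continuous (d_hmono i j s e v)}.
Proof.
move=> x0.
have c (k : R) : {for x, continuous (fun _ : 'rV[R]_3 => k)} by exact: cst_continuous.
have cm i' j' s' e' : {for x, continuous (hmono i' j' s' e')} by exact: continuous_hmono.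
apply: continuous_funB; first do 2?apply: continuous_funD; try by apply: continuous_funM.
by apply: continuous_funM => //; apply: continuous_funM => //; exact: dot_continuous.
Qed.

Lemma C1_on_hmono i j s e : C1_on punctured (hmono i j s e).
Proof.
apply: (C1_on_is_derive (d := fun l => d_hmono i j s e (delta_mx 0 l)) open_punctured).
  by move=> l x x0; exact: is_derive_hmono.
by move=> l x x0; exact: continuous_d_hmono.
Qed.

Lemma partial_hmono l i j s e x : punctured x ->
  partial l (hmono i j s e) x = d_hmono i j s e (delta_mx 0 l) x.
Proof. by move=> x0; rewrite /partial; case: (is_derive_hmono i j s e (delta_mx 0 l) x0). Qed.

Lemma near_punctured (P : 'rV[R]_3 -> Prop) x : (forall y, punctured y -> P y) -> punctured x ->
  \forall y \near x, P y.
Proof.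
move=> HP x0; near=> y; apply: HP; near: y.
by apply: open_nbhs_nbhs; split => //; exact: open_punctured.
Unshelve. all: by end_near. Qed.

Definition dd_hmono l i j s e v x : R :=
  i%:R * a 0 l * d_hmono i.-1 j s e v x
  + j%:R * b 0 l * d_hmono i j.-1 s e v x
  + s%:R * n 0 l * d_hmono i j s.-1 e v x
  - e%:R * (x 0 l * d_hmono i j s e.+2 v x + v 0 l * hmono i j s e.+2 x).

Lemma is_derive_partial_hmono l i j s e v x : punctured x ->
  is_derive x v (partial l (hmono i j s e)) (dd_hmono l i j s e v x).
Proof.
move=> x0.
have E : {near x, d_hmono i j s e (delta_mx 0 l) =1 partial l (hmono i j s e)}.
  by apply: near_punctured x0 => y y0; rewrite partial_hmono.
apply: (near_eq_is_derive E).
have c (k : R) := is_derive_fun_cst k x v.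
have h i' j' s' e' := is_derive_hmono i' j' s' e' v x0.
have xl := is_derive_dot x v (delta_mx 0 l).
have t (k : R) i' j' s' e' := is_derive_funM (c k) (h i' j' s' e').
have t2 := is_derive_funM (is_derive_funM (c e%:R) xl) (h i j s e.+2).
apply: (is_derive_eq (is_derive_funB (is_derive_funD (is_derive_funD
  (t (i%:R * dot (delta_mx 0 l) a) i.-1 j s e) (t (j%:R * dot (delta_mx 0 l) b) i j.-1 s e))
  (t (s%:R * dot (delta_mx 0 l) n) i j s.-1 e)) t2)).
rewrite /dd_hmono !dot_delta [dot x _]dotC [dot v _]dotC !dot_delta !mulr0 !addr0; ring.
Qed.

Lemma C1_on_partial_hmono l i j s e : C1_on punctured (partial l (hmono i j s e)).
Proof.
apply: (C1_on_is_derive (d := fun m => dd_hmono l i j s e (delta_mx 0 m)) open_punctured).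
  by move=> m x x0; exact: is_derive_partial_hmono.
move=> m x x0.
have c (k : R) : {for x, continuous (fun _ : 'rV[R]_3 => k)} by exact: cst_continuous.
have cm i' j' s' e' : {for x, continuous (d_hmono i' j' s' e' (delta_mx 0 m))}.
  exact: continuous_d_hmono.
apply: continuous_funB; first do 2?apply: continuous_funD; try by apply: continuous_funM.
apply: continuous_funM => //; apply: continuous_funD; apply: continuous_funM => //.
  exact: coord_rV3_continuous.
exact: continuous_hmono.
Qed.

Lemma radial_ext_mono i j s : radial_ext (mono i j s) = hmono i j s (i + j + s).
Proof.
apply/funext => x; rewrite /radial_ext /hmono /mono !dotZl !exprMn !exprD.
by move: (_^-1) => r; ring.
Qed.

Lemma C2_mono i j s : C2_hemisphere n (mono i j s).
Proof.
exists punctured; split; [exact: open_punctured|exact: hemisphere_punctured|].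
rewrite radial_ext_mono; split; first exact: C1_on_hmono.
by move=> l; exact: C1_on_partial_hmono.
Qed.

(** Expresses the derivative along v by the partial derivatives.  With v = a, b, n
    or x it collapses the sum over the axes that defines the Laplacian. *)
Lemma d_hmono_sum i j s e v x :
  \sum_(l < 3) v 0 l * d_hmono i j s e (delta_mx 0 l) x = d_hmono i j s e v x.
Proof.
rewrite /d_hmono; move: (hmono i.-1 j s e x) (hmono i j.-1 s e x) (hmono i j s.-1 e x).
move: (hmono i j s e.+2 x) => H4 H1 H2 H3.
under eq_bigr => l _ do rewrite !dot_delta [dot x _]dotC dot_delta mulrBr !mulrDr !mulrA.
rewrite sumrB !big_split/= [dot x v]dotC /dot !mulr_sumr !mulr_suml.
by congr (_ + _ + _ - _); apply: eq_bigr => l _; ring.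
Qed.

Lemma enorm_sphere x : dot x x = 1 -> enorm x = 1.
Proof. by rewrite /enorm => ->; rewrite sqrtr1. Qed.

(** For a homogeneous polynomial P of degree d, the extension constant along rays is
    P / |x|^d, and by Euler's identity its Laplacian on the unit sphere is
    Delta P - d (d + 1) P. *)
Lemma laplace_beltrami_mono i j s x : dot x x = 1 ->
  laplace_beltrami (mono i j s) x =
    (i * i.-1)%:R * mono i.-2 j s x + (j * j.-1)%:R * mono i j.-2 s x
    + (s * s.-1)%:R * mono i j s.-2 x
    - ((i + j + s) * (i + j + s).+1)%:R * mono i j s x.
Proof.
move=> x1; have x0 : punctured x by rewrite /punctured/= x1.
rewrite /laplace_beltrami radial_ext_mono /laplacian3; set e := (i + j + s)%N.
transitivity (\sum_(l < 3) dd_hmono l i j s e (delta_mx 0 l) x).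
  apply: eq_bigr => l _; rewrite {1}/partial.
  by case: (is_derive_partial_hmono l i j s e (delta_mx 0 l) x0).
transitivity (i%:R * d_hmono i.-1 j s e a x + j%:R * d_hmono i j.-1 s e b x
   + s%:R * d_hmono i j s.-1 e n x - e%:R * (d_hmono i j s e.+2 x x + 3 * hmono i j s e.+2 x)).
  have -> : 3 * hmono i j s e.+2 x = \sum_(l < 3) hmono i j s e.+2 x.
    by rewrite sumr_const card_ord mulr_natl.
  rewrite -!d_hmono_sum -big_split/= !mulr_sumr -!big_split/= -sumrB.
  apply: eq_bigr => l _; rewrite /dd_hmono mxE !eqxx mul1r !mulrA.
  by [].
case: F => aa bb nn [ab an bn].
rewrite /d_hmono aa bb nn x1 (dotC b a) (dotC n a) (dotC n b) ab an bn.
rewrite /hmono (enorm_sphere x1) invr1 !expr1n !mulr1 /mono.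
move: (dot x a) (dot x b) (dot x n) => X Y Z {x1 x0 aa bb nn ab an bn}.
(* Euler's identity for one variable, valid also for k = 0. *)
have pw (k : nat) (T : R) : k%:R * (T * T ^+ k.-1) = k%:R * T ^+ k.
  by case: k => [|k]; rewrite ?mul0r// -exprS.
have nS (k : nat) : k.+1%:R = k%:R + 1 :> R by rewrite -addn1 natrD.
rewrite !natrM ?(nS e.+1) ?(nS e).
have -> : e%:R = i%:R + j%:R + s%:R :> R by rewrite /e !natrD.
have := pw i X; have := pw j Y; have := pw s Z.
move: (X ^+ i) (X ^+ i.-1) (X ^+ i.-2) (Y ^+ j) (Y ^+ j.-1) (Y ^+ j.-2).
move: (Z ^+ s) (Z ^+ s.-1) (Z ^+ s.-2) (i%:R) (i.-1%:R) (j%:R) (j.-1%:R) (s%:R) (s.-1%:R).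
move=> z z1 z2 p p1 q q1 r r1 u u1 u2 w w1 w2 Ez Ew Eu.
set d := p + q + r.
transitivity (p * p1 * (u2 * w * z) + q * q1 * (u * w2 * z) + r * r1 * (u * w * z2)
   - 2 * d * (p * (X * u1) * w * z + q * (Y * w1) * u * z + r * (Z * z1) * u * w)
   + d * (d + 2 - 3) * (u * w * z)); first by rewrite /d; ring.
by rewrite Ez Ew Eu /d; ring.
Qed.

End Frame.
End Monomials.

(** * Vanishing of functions with zero moments *)

Section Completeness.
Context {R : realType} (a b n : 'rV[R]_3).
Hypothesis F : orthoframe a b n.
Notation pt := (pt a b n).
Notation Q := (rect 0 (pi / 2) 0 (2 * pi)).
Notation hint := (hint a b n).
Notation hcont := (hcont a b n).
Notation m i j := (mono a b n i j 0).

Lemma continuous_mono i j s : continuous (mono a b n i j s).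
Proof.
suff : forall x, {for x, continuous (mono a b n i j s)} by [].
move=> x; apply: continuous_funM; last exact/continuous_funX/dot_continuous.
by apply: continuous_funM; exact/continuous_funX/dot_continuous.
Qed.

Lemma hcont_mono i j s : hcont (mono a b n i j s).
Proof. by apply: (hcont_of_continuous F) => x _; exact: continuous_mono. Qed.

Lemma hcontD f g : hcont f -> hcont g -> hcont (fun x => f x + g x).
Proof. exact: cont_rectD. Qed.

Lemma dot_self_frame x : dot x x = dot x a ^+ 2 + dot x b ^+ 2 + dot x n ^+ 2.
Proof. by rewrite -[in LHS](comb_dot F x) (dot_comb F) -!expr2. Qed.

(** A polynomial in the two tangential coordinates with its maximum above (p, q).
    Dividing by 8, which bounds squared distances in the unit disk, keeps its values
    on the sphere between 0 and 1. *)
Definition peak (p q : R) x : R :=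
  1 - ((dot x a - p) ^+ 2 + (dot x b - q) ^+ 2) / 8.

Lemma peakE p q x : peak p q x = 1 - ((dot x a - p) ^+ 2 + (dot x b - q) ^+ 2) / 8.
Proof. by []. Qed.

Lemma continuous_peak p q : continuous (peak p q).
Proof.
suff : forall x, {for x, continuous (peak p q)} by [].
move=> x; have c (k : R) : {for x, continuous (fun _ : 'rV[R]_3 => k)} by exact: cst_continuous.
apply: continuous_funB => //; apply: continuous_funM => //.
by apply: continuous_funD; apply: continuous_funX; apply: continuous_funB => //;
  exact: dot_continuous.
Qed.

(** Each factor peak is a combination of monomials of degree at most 2, so powers of
    it can be moved one by one into the monomial. *)
Lemma hint_peak_eq0 v p q : hcont v -> (forall i j, hint (fun x => v x * m i j x) = 0) ->
  forall N i j, hint (fun x => v x * m i j x * peak p q x ^+ N) = 0.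
Proof.
move=> cv v0; elim=> [|N IH] i j.
  by rewrite -[RHS](v0 i j); apply: eq_rint => z _; rewrite expr0 mulr1.
have cp : hcont (fun x => peak p q x ^+ N).
  by apply: (hcont_of_continuous F) => x _; apply: continuous_funX; exact: continuous_peak.
have ct i' j' : hcont (fun x => v x * m i' j' x * peak p q x ^+ N).
  by apply: hcontM cp; apply: hcontM cv _; exact: hcont_mono.
have ck k i' j' := hcontZ (k := k) (ct i' j').
pose c0 := 1 - (p ^+ 2 + q ^+ 2) / 8.
transitivity (hint (fun x => c0 * (v x * m i j x * peak p q x ^+ N) +
   (p / 4 * (v x * m i.+1 j x * peak p q x ^+ N) +
   (q / 4 * (v x * m i j.+1 x * peak p q x ^+ N) +
   ((- 1 / 8) * (v x * m i.+2 j x * peak p q x ^+ N) +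
    (- 1 / 8) * (v x * m i j.+2 x * peak p q x ^+ N)))))).
  apply: eq_rint => z _; congr (_ * _); move: (pt z.1 z.2) => x.
  rewrite exprS; move: (peak p q x ^+ N) => P; rewrite peakE /mono.
  move: (v x) (dot x a) (dot x b) => V X Y.
  by rewrite expr0 !exprS /c0; field.
have c1 := hcontD (ck (-1 / 8) i.+2 j) (ck (-1 / 8) i j.+2).
have c2 := hcontD (ck (q / 4) i j.+1) c1.
have c3 := hcontD (ck (p / 4) i.+1 j) c2.
rewrite (hintD (ck c0 i j) c3) (hintD (ck (p / 4) i.+1 j) c2).
rewrite (hintD (ck (q / 4) i j.+1) c1) (hintD (ck (-1 / 8) i.+2 j) (ck (-1 / 8) i j.+2)).
by rewrite !(hintZ _ (ct _ _)) !IH !mulr0 !addr0.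
Qed.

Lemma colatitude_sin_ge0 (z : R * R) : Q z -> 0 <= sin z.1.
Proof.
move=> [/=]; rewrite !in_itv/= => /andP[t0 t1] _.
apply: sin_ge0_pi; rewrite t0/= (le_trans t1)// ler_pdivrMr// ler_peMr ?pi_ge0//.
by rewrite ler1n.
Qed.

Lemma le_hint f g : hcont f -> hcont g ->
  (forall z, Q z -> f (pt z.1 z.2) <= g (pt z.1 z.2)) -> hint f <= hint g.
Proof.
move=> cf cg fg; apply: le_rint => [| |||z Qz].
- exact: pihalf_gt0.
- exact: twopi_gt0.
- exact: hcont_sin.
- exact: hcont_sin.
by rewrite ler_wpM2l ?fg ?colatitude_sin_ge0.
Qed.

Lemma hint_gt0 f z : hcont f -> (forall x, hemisphere n x -> 0 <= f x) ->
  Q z -> 0 < z.1 -> 0 < f (pt z.1 z.2) -> 0 < hint f.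
Proof.
move=> cf f0 Qz z0 fz; apply: (rint_gt0 _ _ _ _ Qz).
- exact: pihalf_gt0.
- exact: twopi_gt0.
- exact: hcont_sin.
- by move=> y Qy; rewrite mulr_ge0 ?colatitude_sin_ge0// f0//; exact: hemisphere_pt.
- rewrite mulr_gt0// sin_gt0_pi// z0/=.
  move: Qz => [/=]; rewrite !in_itv/= => /andP[_ t1] _.
  by rewrite (le_lt_trans t1)// ltr_pdivrMr// ltr_pMr ?pi_gt0// ltr1n.
Qed.

Lemma norm_le_enorm (x : 'rV[R]_3) : `|x| <= enorm x.
Proof.
apply: norm_rV3_le => [|i]; first exact: sqrtr_ge0.
rewrite -sqrtr_sqr ler_wsqrtr// /dot (bigD1 i)//= -expr2 lerDl.
by apply: sumr_ge0 => j _; rewrite -expr2 sqr_ge0.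
Qed.

(** On the hemisphere the height is determined by the tangential coordinates, as
    the nonnegative square root of 1 - X^2 - Y^2.  That root is only 1/2-Holder
    continuous at the equator, whence e of the order of eta^2. *)
Lemma hemisphere_close x0 (eta : R) : hemisphere n x0 -> 0 < eta ->
  exists2 e : R, 0 < e <= 1 & forall x, hemisphere n x ->
    (dot x a - dot x0 a) ^+ 2 + (dot x b - dot x0 b) ^+ 2 < e ^+ 2 -> `|x0 - x| < eta.
Proof.
move=> [/sphere2P S0 Z0] eta0.
pose e := Num.min 1 (eta ^+ 2 / 6).
have eta2 : 0 < eta ^+ 2 / 6 by rewrite divr_gt0// exprn_gt0.
have e0 : 0 < e by rewrite lt_min ltr01.
have e1 : e <= 1 by rewrite ge_min lexx.
have e2 : e <= eta ^+ 2 / 6 by rewrite ge_min lexx orbT.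
exists e; first by rewrite e0.
move=> x [/sphere2P S Z] D.
rewrite (le_lt_trans (norm_le_enorm _))// -[ltRHS]gtr0_norm// -sqrtr_sqr.
rewrite ltr_sqrt ?exprn_gt0// dot_self_frame.
have dB y : dot (x0 - x) y = dot x0 y - dot x y by rewrite dotDl -scaleN1r dotZl mulN1r.
rewrite !dB; rewrite !dot_self_frame in S0 S.
move: (dot x a) (dot x b) (dot x n) (dot x0 a) (dot x0 b) (dot x0 n) S Z S0 Z0 D.
move=> X Y W p q r S W0 S0 r0 D {dB}.
clearbody e.
have bound u v : u ^+ 2 + v ^+ 2 < e ^+ 2 -> `|u| < e.
  by move=> uv; rewrite ltr_norml; apply/andP; split; nra.
have HX := bound _ _ D.
have HY : `|Y - q| < e by apply: (bound _ (X - p)); rewrite addrC.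
have unit_le (u v w : R) : u ^+ 2 + v ^+ 2 + w ^+ 2 = 1 -> `|u| <= 1.
  by move=> uvw; rewrite ler_norml; apply/andP; split; nra.
have prod u v : `|u| <= 1 -> `|v| <= 1 -> `|u - v| < e -> `|u ^+ 2 - v ^+ 2| <= 2 * e.
  move=> u1 v1 uv; rewrite subr_sqr normrM mulrC ler_pM// ?(ltW uv)//.
  by rewrite (le_trans (ler_normD _ _))//; lra.
have PX := prod _ _ (unit_le _ _ _ S) (unit_le _ _ _ S0) HX.
have PY : `|Y ^+ 2 - q ^+ 2| <= 2 * e.
  apply: prod HY; first by apply: (unit_le _ X W); rewrite -S; ring.
  by apply: (unit_le _ p r); rewrite -S0; ring.
have HW : (r - W) ^+ 2 <= 4 * e.
  have PW : `|r ^+ 2 - W ^+ 2| <= 4 * e.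
    have -> : r ^+ 2 - W ^+ 2 = (X ^+ 2 - p ^+ 2) + (Y ^+ 2 - q ^+ 2) by lra.
    by rewrite (le_trans (ler_normD _ _))//; lra.
  rewrite (le_trans _ PW)// subr_sqr normrM -real_normK ?num_real// expr2 ler_wpM2l//.
  by rewrite [leRHS]ger0_norm ?addr_ge0// ler_norml; lra.
nra.
Qed.

Lemma bernoulli_ineq (h : R) N : 0 <= h -> 1 + N%:R * h <= (1 + h) ^+ N.
Proof.
move=> h0; elim: N => [|N IH]; first by rewrite mul0r addr0 expr0.
have N0 : 0 <= N%:R :> R by [].
rewrite exprS -addn1 natrD (le_trans _ (ler_wpM2l _ IH)) ?addr_ge0//; nra.
Qed.

(** A geometric sequence of ratio k / l > 1 is unbounded. *)
Lemma geometric_gap (A B k l : R) : 0 < A -> 0 < l < k ->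
  (forall N, A * k ^+ N <= B * l ^+ N) -> False.
Proof.
move=> A0 /andP[l0 lk] H.
pose h := k / l - 1.
have h0 : 0 < h by rewrite subr_gt0 ltr_pdivlMr// mul1r.
have E N : A * (1 + N%:R * h) <= B.
  have := H N; have -> : k = l * (1 + h) by rewrite /h; field; rewrite gt_eqF.
  rewrite exprMn mulrCA [B * _]mulrC ler_pM2l ?exprn_gt0//; apply: le_trans.
  by rewrite ler_wpM2l ?(ltW A0)// bernoulli_ineq// ltW.
have := E (Num.truncn (B / (A * h))).+1.
have := truncnS_gt (B / (A * h)); rewrite ltr_pdivrMr ?mulr_gt0//.
by move: (_.+1%:R) => m; nra.
Qed.

(** Integrate v against high powers of peak.  Where v may be negative, peak is at
    most some k2 < 1, so the contribution is at least - M k2^N with M constant;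
    near the point, peak is at least some k1 > k2 and v is bounded below by a
    positive number, so the contribution is at least a constant times k1^N.  The integral being
      zero for all N, this
    contradicts geometric_gap.  The colatitude is nonzero because the weight
    sin t vanishes at the pole. *)
Lemma not_gt0_of_moments (v : 'rV[R]_3 -> R) (z0 : R * R) :
  (forall x, hemisphere n x -> {for x, continuous v}) ->
  (forall i j, hint (fun x => v x * m i j x) = 0) ->
  Q z0 -> 0 < z0.1 -> 0 < v (pt z0.1 z0.2) -> False.
Proof.
move=> cv v0 Qz0 z00 vz0.
have hv : hcont v by exact: hcont_of_continuous.
set x0 := pt z0.1 z0.2 in vz0; have Hx0 : hemisphere n x0 by exact: hemisphere_pt.
set c := v x0 in vz0; have c2 : 0 < c / 2 by rewrite divr_gt0.
have /cvgrPdist_lt/(_ _ c2)/nbhs_ballP[eta /= eta0 Heta] := cv x0 Hx0.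
have [e /andP[e0 e1] He] := hemisphere_close Hx0 eta0.
pose p := dot x0 a; pose q := dot x0 b.
pose D x := (dot x a - p) ^+ 2 + (dot x b - q) ^+ 2.
have D0 x : 0 <= D x by rewrite addr_ge0 ?sqr_ge0.
have vc x : hemisphere n x -> D x < e ^+ 2 -> c / 2 < v x.
  move=> Hx Dx; have /Heta : ball x0 eta x by rewrite -ball_normE; apply: He.
  by rewrite /= -/c ltr_norml; lra.
have cD : hcont D.
  apply: (hcont_of_continuous F) => x _.
  have cc (k : R) : {for x, continuous (fun _ : 'rV[R]_3 => k)} by exact: cst_continuous.
  by apply: continuous_funD; apply: continuous_funX; apply: continuous_funB => //;
    exact: dot_continuous.
have e2 : 0 < e ^+ 2 by rewrite exprn_gt0.
have e21 : e ^+ 2 <= 1 by rewrite exprn_ile1// ltW.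
(* A continuous cut-off supported in D < e^2 / 2 with values in [0, 1]. *)
pose psi x := `|e ^+ 2 / 2 - D x| + (e ^+ 2 / 2 - D x).
have cpsi : hcont psi.
  have c1 : hcont (fun x => e ^+ 2 / 2 - D x) by apply: cont_rectB => //; exact: cont_rect_cst.
  apply: cont_rectD => //; move=> z Qz; apply: (@continuous_comp _ _ _ _ (@Num.norm R R)).
    exact: c1.
  exact: norm_continuous.
have psi0 x : 0 <= psi x by rewrite /psi -[X in _ + X]opprK subr_ge0 -normrN ler_norm.
have [M M0 HM] : exists2 M : R, 0 < M & forall z, Q z -> `|v (pt z.1 z.2)| <= M.
  exact: cont_rect_bounded hv.
pose k1 := 1 - e ^+ 2 / 16; pose k2 := 1 - e ^+ 2 / 8.
have K x : peak p q x = 1 - D x / 8 by [].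
have D8 x : hemisphere n x -> D x <= 8.
  have aux (X Y W p' q' r : R) : X ^+ 2 + Y ^+ 2 + W ^+ 2 = 1 ->
      p' ^+ 2 + q' ^+ 2 + r ^+ 2 = 1 -> (X - p') ^+ 2 + (Y - q') ^+ 2 <= 8.
    move=> h1 h2; have := sqr_ge0 (X + p'); have := sqr_ge0 (Y + q').
    by have := sqr_ge0 W; have := sqr_ge0 r; nra.
  move=> [/sphere2P S _]; have [/sphere2P S0 _] := Hx0.
  by rewrite !dot_self_frame in S S0; exact: aux S S0.
have key N : c / 2 * hint psi * k1 ^+ N <= M * hint (fun=> 1) * k2 ^+ N.
  have cK : hcont (fun x => v x * m 0 0 x * peak p q x ^+ N).
    apply: hcontM; first by apply: hcontM => //; exact: hcont_mono.
    by apply: (hcont_of_continuous F) => x _; apply: continuous_funX; exact: continuous_peak.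
  have c1 : hcont (fun=> 1) by exact: cont_rect_cst.
  have cA := hcontZ (k := c / 2 * k1 ^+ N) cpsi.
  have cB := hcontZ (k := - (M * k2 ^+ N)) c1.
  have : hint (fun x => c / 2 * k1 ^+ N * psi x + - (M * k2 ^+ N) * 1) <= 0.
    rewrite -(hint_peak_eq0 p q hv v0 N 0 0); apply: (le_hint _ cK).
      by apply: hcontD => //; exact: cB.
    move=> z Qz; have := vc _ (hemisphere_pt F Qz); have := HM z Qz;
      have := D8 _ (hemisphere_pt F Qz).
    have := D0 (pt z.1 z.2).
    rewrite K /psi /mono !expr0 !mulr1; move: (v _) (D _) => w d d0 d8 wM wc.
    have k10 : 0 <= k1 by rewrite /k1; lra.
    have k20 : 0 <= k2 by rewrite /k2; lra.
    have P1 : 0 <= k1 ^+ N by rewrite exprn_ge0.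
    have P2 : 0 <= M * k2 ^+ N by rewrite mulr_ge0 ?exprn_ge0// ltW.
    have K0 : 0 <= 1 - d / 8 by lra.
    (* Three zones: far from the point, in between where the cut-off is zero, and
       near the point. *)
    have [de|de] := leP (e ^+ 2) d.
      rewrite ler0_norm; last by lra.
      rewrite addNr mulr0 add0r.
      have K2 : (1 - d / 8) ^+ N <= k2 ^+ N by apply: lerXn2r; rewrite ?nnegrE// /k2; lra.
      have : - (M * k2 ^+ N) <= - `|w| * (1 - d / 8) ^+ N.
        by rewrite mulNr lerN2 ler_pM// exprn_ge0.
      move=> H; apply: (le_trans H); rewrite ler_wpM2r ?exprn_ge0//.
      by rewrite lerNl -normrN ler_norm.
    have {}wc := wc de.
    have [de2|de2] := leP (e ^+ 2 / 2) d.
      rewrite ler0_norm; last by lra.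
      rewrite addNr mulr0 add0r (@le_trans _ _ 0)// ?oppr_le0// mulr_ge0 ?exprn_ge0//; lra.
    rewrite gtr0_norm; last by lra.
    have K1 : k1 ^+ N <= (1 - d / 8) ^+ N by apply: lerXn2r; rewrite ?nnegrE// /k1; lra.
    have : c / 2 * k1 ^+ N <= w * (1 - d / 8) ^+ N by rewrite ler_pM// ltW.
    apply: le_trans; rewrite -[leRHS]addr0 lerD ?oppr_le0//.
    rewrite ler_piMr ?mulr_ge0 ?(ltW c2)//; lra.
  rewrite (hintD cA cB) (hintZ _ cpsi) (hintZ _ c1).
  by rewrite mulNr subr_le0 mulrAC [leRHS]mulrAC.
apply: (geometric_gap _ _ key).
  rewrite mulr_gt0//; apply: (hint_gt0 cpsi _ Qz0 z00) => //.
  rewrite -/x0 /psi /D !subrr !expr0n/= addr0 subr0 ger0_norm ?divr_ge0 ?(ltW e2)//.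
  by rewrite addr_gt0 ?divr_gt0.
by rewrite /k1 /k2; apply/andP; split; lra.
Qed.

Lemma eq0_of_moments (v : 'rV[R]_3 -> R) :
  (forall x, hemisphere n x -> {for x, continuous v}) ->
  (forall i j, hint (fun x => v x * m i j x) = 0) ->
  forall z, Q z -> v (pt z.1 z.2) = 0.
Proof.
move=> cv v0; have hv : hcont v by exact: hcont_of_continuous.
apply: (cont_rect_eq0 (@pihalf_gt0 R) hv) => z Qz /andP[z0 _].
case: (ltgtP 0 (v (pt z.1 z.2))) => // vz; exfalso.
  exact: (not_gt0_of_moments cv v0 Qz z0 vz).
pose v' x := -1 * v x.
have cv' x : hemisphere n x -> {for x, continuous v'}.
  by move=> Hx; apply: continuous_funM; [exact: cst_continuous|exact: cv].
apply: (not_gt0_of_moments cv' _ Qz z0) => [i j|]; last by rewrite /v' mulN1r oppr_gt0.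
have hvm : hcont (fun x => v x * m i j x) by apply: hcontM => //; exact: hcont_mono.
rewrite -[RHS](mulr0 (-1)) -[in RHS](v0 i j) -(hintZ _ hvm).
by apply: eq_rint => z' _; rewrite /v' !mulrA.
Qed.

Lemma hemisphere_ptP x : hemisphere n x -> exists2 z, Q z & x = pt z.1 z.2.
Proof.
move=> [/sphere2P S Z0]; rewrite dot_self_frame in S.
have E p q r : p = dot x a -> q = dot x b -> r = dot x n -> x = comb a b n p q r.
  by move=> -> -> ->; rewrite (comb_dot F).
move: E S Z0; move: (dot x a) (dot x b) (dot x n) => X Y Z E S Z0.
have Z1 : Z <= 1 by nra.
have Zi : -1 <= Z <= 1 by rewrite Z1 andbT; lra.
have t0 := acos_ge0 Zi.
have t1 : acos Z <= pi / 2.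
  rewrite leNgt; apply/negP => H.
  have : cos (acos Z) < cos (pi / 2).
    rewrite ltr_cos// in_itv/= ?t0 ?acos_lepi//.
    by rewrite ltW ?pihalf_gt0//= ler_pdivrMr// ler_peMr ?pi_ge0// ler1n.
  by rewrite acosK ?in_itv// cos_pihalf ltNge Z0.
have s2 : sin (acos Z) ^+ 2 = X ^+ 2 + Y ^+ 2.
  by rewrite sin2cos2 acosK// -S; ring.
have s0 : 0 <= sin (acos Z).
  by apply: sin_ge0_pi; rewrite t0 acos_lepi.
have rangeQ p : 0 <= p <= 2 * pi -> Q (acos Z, p).
  by move=> p0; split; rewrite /= in_itv/= ?t0 ?t1.
have [sz|sn0] := eqVneq (sin (acos Z)) 0.
  exists (acos Z, 0); first by apply: rangeQ; rewrite lexx ltW// twopi_gt0.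
  have [X0 Y0] : X = 0 /\ Y = 0 by rewrite sz expr0n/= in s2; split; nra.
  by apply: E; rewrite /= ?sz ?mul0r ?acosK.
have sp : 0 < sin (acos Z) by rewrite lt_neqAle eq_sym sn0.
set s := sin (acos Z) in sn0 sp s2.
pose c := X / s; pose d := Y / s.
have cs : c ^+ 2 + d ^+ 2 = 1 by rewrite !expr_div_n -mulrDl -s2 divff// sqrf_eq0.
have ci : -1 <= c <= 1 by apply/andP; split; nra.
have [a0 a1] := (acos_ge0 ci, acos_lepi ci).
have ca : cos (acos c) = c by rewrite acosK ?in_itv.
have sa : sin (acos c) = `|d|.
  by rewrite sin_acos// -sqrtr_sqr -cs addrC addKr.
have pt_angle p : cos p = c -> sin p = d -> x = pt (acos Z) p.
  move=> cp sp'; apply: E; rewrite /= ?cp ?sp' ?acosK ?in_itv// -/s.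
    by rewrite /c mulrC divfK.
  by rewrite /d mulrC divfK.
have [d0|d0] := leP 0 d.
  exists (acos Z, acos c); first by apply: rangeQ; rewrite a0/=; have := pi_ge0 R; lra.
  by apply: pt_angle => //; rewrite sa ger0_norm.
exists (acos Z, - acos c + pi *+ 2).
  by apply: rangeQ; rewrite mulr2n; have := pi_ge0 R; lra.
by apply: pt_angle; rewrite ?cosD2pi ?cosN// sinD2pi sinN sa ltr0_norm// opprK.
Qed.

End Completeness.

(** * Linear combinations of solutions *)

Section LinearCombinations.
Context {R : realType}.
Implicit Types (f g u v : 'rV[R]_3 -> R) (W : set 'rV[R]_3).

Lemma near_open W x : open W -> W x -> \forall y \near x, W y.
Proof. by move=> oW Wx; apply: open_nbhs_nbhs. Qed.

Lemma eq_partial W f g i x : open W -> (forall y, W y -> f y = g y) -> W x ->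
  partial i f x = partial i g x.
Proof.
move=> oW fg Wx; apply: near_eq_derive; near=> y; apply: fg.
by near: y; exact: near_open.
Unshelve. all: by end_near. Qed.

Lemma C1_on_eq W f g : open W -> (forall y, W y -> f y = g y) -> C1_on W f -> C1_on W g.
Proof.
move=> oW fg df; apply: (C1_on_is_derive (d := fun i => partial i f) oW) => i x Wx.
  have [/derivableP dfx _] := df i x Wx.
  apply: near_eq_is_derive dfx; near=> y; apply: fg; near: y; exact: near_open.
by case: (df i x Wx).
Unshelve. all: by end_near. Qed.

Lemma is_derive_lin W f g (c : R) i x : C1_on W f -> C1_on W g -> W x ->
  is_derive x (delta_mx 0 i) (fun y => c * f y + g y) (c * partial i f x + partial i g x).
Proof.
move=> df dg Wx; have [/derivableP dfx _] := df i x Wx; have [/derivableP dgx _] := dg i x Wx.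
have := is_derive_funD (is_derive_funM (is_derive_fun_cst c x (delta_mx 0 i)) dfx) dgx.
by rewrite mulr0 addr0.
Qed.

Lemma partial_lin W f g (c : R) i x : C1_on W f -> C1_on W g -> W x ->
  partial i (fun y => c * f y + g y) x = c * partial i f x + partial i g x.
Proof. by move=> df dg Wx; case: (is_derive_lin c i df dg Wx). Qed.

Lemma C1_on_lin W f g (c : R) : open W -> C1_on W f -> C1_on W g ->
  C1_on W (fun y => c * f y + g y).
Proof.
move=> oW df dg; apply: (C1_on_is_derive (d := fun i y => c * partial i f y + partial i g y) oW)
  => i x Wx.
  exact: is_derive_lin Wx.
apply: continuous_funD; last by case: (dg i x Wx).
by apply: continuous_funM; [exact: cst_continuous|case: (df i x Wx)].
Qed.

Lemma C2_on_lin W f g (c : R) : open W -> C2_on W f -> C2_on W g ->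
  C2_on W (fun y => c * f y + g y).
Proof.
move=> oW [df d2f] [dg d2g]; split; first exact: (C1_on_lin c oW df dg).
move=> i; apply: (C1_on_eq oW (f := fun y => c * partial i f y + partial i g y)).
  by move=> y Wy; rewrite (partial_lin c i df dg Wy).
exact: (C1_on_lin c oW (d2f i) (d2g i)).
Qed.

Lemma laplacian3_lin W f g (c : R) x : open W -> C2_on W f -> C2_on W g -> W x ->
  laplacian3 (fun y => c * f y + g y) x = c * laplacian3 f x + laplacian3 g x.
Proof.
move=> oW [df d2f] [dg d2g] Wx; rewrite /laplacian3 mulr_sumr -big_split/=.
apply: eq_bigr => i _; rewrite -(partial_lin c i (d2f i) (d2g i) Wx).
by apply: (eq_partial i oW) => // y Wy; exact: partial_lin Wy.
Qed.

Lemma C2_onS W W' f : W `<=` W' -> C2_on W' f -> C2_on W f.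
Proof.
move=> WW' [df d2f]; split=> [i x /WW'|i j x /WW']; first exact: df.
exact: d2f.
Qed.

Section BoundaryValueProblem.
Variables (n : 'rV[R]_3) (bc : boundary_condition).

(** The notion is linear in the pair (u, f), so that monomials, which are not
    eigenfunctions, can be combined into eigenfunctions. *)
Definition solves u f := [/\ C2_hemisphere n u, satisfies_bc bc n u &
  forall p, hemisphere_interior n p -> laplace_beltrami u p = f p].

Lemma solves_eq u f g : (forall p, sphere2 p -> f p = g p) -> solves u f -> solves u g.
Proof. by move=> fg [Cu bu Lu]; split=> // p Hp; rewrite Lu// fg//; case: Hp. Qed.

Lemma solves0 : solves (fun=> 0) (fun=> 0).
Proof.
have E : radial_ext (fun=> 0) = (fun=> 0) :> ('rV[R]_3 -> R) by [].
have P i : partial i (fun=> 0) = (fun=> 0) :> ('rV[R]_3 -> R).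
  by apply/funext => x; exact: derive_cst.
have C : C1_on setT ((fun=> 0) : 'rV[R]_3 -> R).
  move=> i x _; split; first exact: derivable_cst.
  by rewrite P; exact: cst_continuous.
split.
- exists setT; split; [exact: openT|by []|rewrite E; split; first exact: C].
  by move=> i; rewrite P; exact: C.
- move=> p _; case: bc => //; rewrite E; exact: derive_cst.
- by move=> p _; rewrite /laplace_beltrami E /laplacian3 big1// => i _; rewrite !P.
Qed.

Lemma hemisphere_interior_sub : hemisphere_interior n `<=` hemisphere n.
Proof. by move=> x [sx /ltW]. Qed.

Lemma hemisphere_boundary_sub : hemisphere_boundary n `<=` hemisphere n.
Proof. by move=> x [sx xn]; split; rewrite ?xn. Qed.

Lemma solves_lin (c : R) u v f g : solves u f -> solves v g ->
  solves (fun x => c * u x + v x) (fun x => c * f x + g x).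
Proof.
move=> [[U [oU HU Cu]] bu Lu] [[V [oV HV Cv]] bv Lv].
pose W := U `&` V.
have oW : open W by exact: openI.
have HW : hemisphere n `<=` W by move=> x Hx; split; [exact: HU|exact: HV].
have {}Cu : C2_on W (radial_ext u) by apply: C2_onS Cu; exact: subIsetl.
have {}Cv : C2_on W (radial_ext v) by apply: C2_onS Cv; exact: subIsetr.
split.
- by exists W; split; [exact: oW|exact: HW|exact: (C2_on_lin c oW Cu Cv)].
- move=> p Hp; have Wp := HW _ (hemisphere_boundary_sub Hp).
  have := bu p Hp; have := bv p Hp; case: (bc) => [Ev Eu|-> ->]; last by rewrite mulr0 addr0.
  have /diff_derivable/derivableP du := C1_on_differentiable oW Cu.1 Wp.
  have /diff_derivable/derivableP dv := C1_on_differentiable oW Cv.1 Wp.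
  have [_ ->] := is_derive_funD
    (is_derive_funM (is_derive_fun_cst c p (- n)) (du (- n))) (dv (- n)).
  by rewrite Eu Ev !mulr0 !addr0.
- move=> p Hp; have Wp := HW _ (hemisphere_interior_sub Hp).
  by rewrite /laplace_beltrami (laplacian3_lin c oW Cu Cv Wp) -Lu// -Lv.
Qed.

Lemma solves_sum N (c : 'I_N -> R) (u f : 'I_N -> 'rV[R]_3 -> R) :
  (forall i, solves (u i) (f i)) ->
  solves (fun x => \sum_(i < N) c i * u i x) (fun x => \sum_(i < N) c i * f i x).
Proof.
elim: N c u f => [|N IH] c u f uf.
  rewrite (_ : (fun x => _) = fun=> 0); last by apply/funext => x; rewrite big_ord0.
  rewrite [X in solves _ X](_ : _ = fun=> 0); last by apply/funext => x; rewrite big_ord0.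
  exact: solves0.
have recl (h : 'I_N.+1 -> 'rV[R]_3 -> R) : (fun x => \sum_(i < N.+1) c i * h i x) =
    (fun x => c ord0 * h ord0 x + \sum_(i < N) c (lift ord0 i) * h (lift ord0 i) x).
  by apply/funext => x; rewrite big_ord_recl.
rewrite !recl; apply: (solves_lin (c ord0) (uf ord0)).
exact: (IH (fun i => c (lift ord0 i)) _ _ (fun i => uf (lift ord0 i))).
Qed.

Lemma eigenspace_bcE mu u : eigenspace_bc bc n mu u <-> solves u (fun x => - mu * u x).
Proof.
split=> [[Cu bu Lu]|[Cu bu Lu]]; split => // p Hp.
  by rewrite mulNr -Lu// opprK.
by rewrite Lu// mulNr opprK.
Qed.

End BoundaryValueProblem.
End LinearCombinations.

(** * Moments of eigenfunctions *)

Section Eigenspaces.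
Context {R : realType} (a b n : 'rV[R]_3).
Hypothesis F : orthoframe a b n.
Variable bc : boundary_condition.
Notation pt := (pt a b n).
Notation Q := (rect 0 (pi / 2) 0 (2 * pi)).
Notation hint := (hint a b n).
Notation hcont := (hcont a b n).

(** The exponent of the height: even functions of the height satisfy the Neumann
    condition and odd ones the Dirichlet condition, and 0 and 1 are the exponents
    for which the term with s (s - 1) is absent from the Laplacian of a monomial. *)
Definition parity : nat := match bc with Neumann => 0 | Dirichlet => 1 end.

Notation m i j := (mono a b n i j parity).
Notation solves := (solves n bc).

(** For Neumann, the two tangential coordinates and the norm are stationary in the
    direction n along the boundary circle; for Dirichlet, the factor Z is zero. *)
Lemma mono_bc i j : satisfies_bc bc n (m i j).
Proof.
case: F => aa bb nn [ab an bn].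
have dN y z : dot (- y) z = - dot y z by rewrite -scaleN1r dotZl mulN1r.
rewrite /parity; case: bc => p [/sphere2P sp pn].
  rewrite (radial_ext_mono a b n).
  have x0 : punctured p by rewrite /punctured/= sp.
  have [_ ->] := is_derive_hmono a b n i j 0 (i + j + 0) (- n) x0.
  rewrite /d_hmono !dN (dotC n a) (dotC n b) an bn [dot p _]dotC dN dotC pn.
  by rewrite oppr0 !mulr0 !mul0r !addr0 subr0.
by rewrite /mono pn expr1 mulr0.
Qed.

Definition degree_eigenvalue (d : nat) : R := (d * d.+1)%:R.

Lemma solves_mono i j : solves (m i j) (fun x =>
  (i * i.-1)%:R * m i.-2 j x + (j * j.-1)%:R * m i j.-2 x
  - degree_eigenvalue (i + j + parity) * m i j x).
Proof.
split; [exact: C2_mono|exact: mono_bc|].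
move=> x [/sphere2P x1 _]; rewrite (laplace_beltrami_mono F)//.
have -> : (parity * parity.-1 = 0)%N by rewrite /parity; case: bc.
by rewrite mul0r addr0.
Qed.

Lemma hcont_solves u f : solves u f -> hcont u.
Proof.
by move=> [[U [oU HU Cu]] _ _]; have := hcont_C2 F oU HU Cu; rewrite (hcont_radial_ext F).
Qed.

(** Green's formula for boundary value problems.  The equations hold in the open
    hemisphere only and are extended to the equator by continuity. *)
Lemma hint_solves u v f g : solves u f -> solves v g -> hcont f -> hcont g ->
  hint (fun x => v x * f x) = hint (fun x => u x * g x).
Proof.
move=> su sv cf cg.
have onQ w h : solves w h -> hcont h -> forall z, Q z ->
    laplace_beltrami w (pt z.1 z.2) = h (pt z.1 z.2).
  move=> [[W [oW HW Cw]] _ Lw] ch z Qz; apply/eqP; rewrite -subr_eq0; apply/eqP.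
  have cL := hcont_laplace_beltrami F HW Cw.
  apply: (cont_rect_eq0 (@pihalf_gt0 R) (cont_rectB cL ch) _ Qz) => y Qy /andP[_ y1].
  by rewrite Lw ?subrr//; exact: (hemisphere_interior_pt F).
have [Cu bu _] := su; have [Cv bv _] := sv.
have G := green_hemisphere F Cu Cv bu bv.
transitivity (hint (fun x => v x * laplace_beltrami u x)).
  by apply: eq_rint => z Qz; rewrite (onQ _ _ su cf z Qz).
rewrite G; apply: eq_rint => z Qz; rewrite (onQ _ _ sv cg z Qz) //.
Qed.

Definition moment u i j : R := hint (fun x => u x * m i j x).

(** Green's formula applied to u and to a monomial. *)
Lemma moment_rec mu u i j : eigenspace_bc bc n mu u ->
  (degree_eigenvalue (i + j + parity) - mu) * moment u i j =
  (i * i.-1)%:R * moment u i.-2 j + (j * j.-1)%:R * moment u i j.-2.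
Proof.
move=> /eigenspace_bcE su; have cu := hcont_solves su.
have cm i' j' : hcont (m i' j') by exact: (hcont_mono F).
have cum i' j' : hcont (fun x => u x * m i' j' x) by exact: hcontM.
set d := degree_eigenvalue _.
pose g1 x := (i * i.-1)%:R * (u x * m i.-2 j x).
pose g2 x := (j * j.-1)%:R * (u x * m i j.-2 x).
pose g3 x := - d * (u x * m i j x).
have c1 : hcont g1 by exact: hcontZ.
have c2 : hcont g2 by exact: hcontZ.
have c3 : hcont g3 by exact: hcontZ.
have E := hint_solves su (solves_mono i j) (hcontZ (k := - mu) cu) _.
have {E} : hint (fun x => - mu * (u x * m i j x)) = hint (fun x => g1 x + (g2 x + g3 x)).
  transitivity (hint (fun x => m i j x * (- mu * u x))).
    by apply: eq_rint => z _; congr (_ * _); rewrite mulrA mulrC.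
  rewrite E; last first.
    apply: cont_rectB; last exact: hcontZ.
    by apply: cont_rectD; exact: hcontZ.
  apply: eq_rint => z _; congr (_ * _); rewrite /g1 /g2 /g3 -/d.
  move: (u _) (m i j _) (m i.-2 j _) (m i j.-2 _) => p q r s; ring.
rewrite (hintD c1 (hcontD c2 c3)) (hintD c2 c3) !hintZ// -!/(moment u _ _).
move: (moment u i j) (moment u i.-2 j) (moment u i j.-2) => p q r E.
have -> : (d - mu) * p = d * p + - mu * p by ring.
by rewrite E; ring.
Qed.

(** Induction on i + j with moment_rec, in which the factor of the moment is nonzero
    except in the degrees where the moment vanishes by assumption. *)
Lemma moments_eq0 mu u : eigenspace_bc bc n mu u ->
  (forall i j, degree_eigenvalue (i + j + parity) = mu -> moment u i j = 0) ->
  forall i j, moment u i j = 0.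
Proof.
move=> Eu H0 i j; have [k] := ubnP (i + j); elim: k i j => // k IH i j ijk.
have [|dmu] := eqVneq (degree_eigenvalue (i + j + parity)) mu; first exact: H0.
have low2 (p : nat) (x : R) : ((1 < p)%N -> x = 0) -> (p * p.-1)%:R * x = 0.
  by case: p => [|[|p]] h; rewrite ?mul0r//= ?muln0 ?mul0r// h// mulr0.
have e1 : (i * i.-1)%:R * moment u i.-2 j = 0 by apply: low2 => p1; apply: IH; lia.
have e2 : (j * j.-1)%:R * moment u i j.-2 = 0 by apply: low2 => p1; apply: IH; lia.
have := moment_rec i j Eu; rewrite e1 e2 addr0.
by move/eqP; rewrite mulf_eq0 subr_eq0 (negbTE dmu)/= => /eqP.
Qed.

(** The moments of u are those of u Z^s against monomials in X and Y alone, so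
    eq0_of_moments applies to u Z^s.  For Dirichlet the factor Z can be removed off
    the equator, and on the equator u is zero by the boundary condition. *)
Lemma eigenfunction_eq0 mu u : eigenspace_bc bc n mu u ->
  (forall i j, moment u i j = 0) -> forall x, hemisphere n x -> u x = 0.
Proof.
move=> Eu M0 x Hx.
have [[U [oU HU Cu]] bu _] := Eu.
(* Only the radial extension of u is known to be continuous in space. *)
pose v y := radial_ext u y * dot y n ^+ parity.
have cv y : hemisphere n y -> {for y, continuous v}.
  move=> Hy; apply: continuous_funM; last exact/continuous_funX/dot_continuous.
  by apply: C1_on_continuous Cu.1 (HU _ Hy).
have V0 := eq0_of_moments F cv.
have [z Qz xz] := hemisphere_ptP F Hx.
have {V0} : v x = 0.
  rewrite xz; apply: V0 Qz => i j; rewrite -[RHS](M0 i j).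
  apply: eq_rint => y _; congr (_ * _); rewrite /v (radial_ext_pt F) /mono expr0 mulr1.
  move: (u _) (dot _ a ^+ i) (dot _ b ^+ j) (dot _ n ^+ _) => p q r s; ring.
rewrite /v radial_ext_sphere; last by case: Hx => /sphere2P.
move=> /eqP; rewrite mulf_eq0 => /orP[/eqP //|].
have [x0|x0] := eqVneq (dot x n) 0; last by rewrite expf_eq0 (negbTE x0) andbF.
have Bx : hemisphere_boundary n x by split; [case: Hx|].
have := bu x Bx; rewrite /parity; case: bc => //.
by rewrite expr0 oner_eq0.
Qed.

End Eigenspaces.

(** * Dimension of the eigenspaces *)

Section PolynomialVanishing.
Context {R : realType}.

Lemma poly_eq0_of_itv (p : {poly R}) (h : R) : 0 < h ->
  (forall t, 0 < t < h -> p.[t] = 0) -> p = 0.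
Proof.
move=> h0 ph; apply/eqP; case: eqVneq => // pn0; exfalso.
pose rs := [seq h / i.+2%:R | i <- iota 0 (size p)].
have urs : uniq rs.
  rewrite map_inj_uniq ?iota_uniq// => i j /(mulfI (lt0r_neq0 h0))/invr_inj/eqP.
  by rewrite eqr_nat => /eqP[].
have ars : all (root p) rs.
  apply/allP => _ /mapP[i _ ->]; apply/rootP/ph.
  by rewrite divr_gt0//= ltr_pdivrMr// ltr_pMr// ltr1n.
by have := max_poly_roots pn0 ars urs; rewrite size_map size_iota ltnn.
Qed.

End PolynomialVanishing.

Section Dimension.
Context {R : realType} (a b n : 'rV[R]_3).
Hypothesis F : orthoframe a b n.
Variable bc : boundary_condition.
Notation parity := (parity bc).
Notation m i j := (mono a b n i j parity).
Notation solves := (solves n bc).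
Notation ev := (@degree_eigenvalue R).
Notation E := (eigenspace_bc bc n).
Notation H := (hemisphere n).
Notation moment := (moment a b n bc).

(** Linear combinations of monomials are encoded by lists of coefficients and
    exponents, so that their degree can be bounded by a test on the list. *)
Definition combo (c : seq (R * (nat * nat))) x : R :=
  \sum_(t <- c) t.1 * m t.2.1 t.2.2 x.

Definition scale_combo (r : R) (c : seq (R * (nat * nat))) := [seq (r * t.1, t.2) | t <- c].

Definition low k (c : seq (R * (nat * nat))) :=
  all (fun t => (t.2.1 + t.2.2 + parity < k)%N) c.

Lemma combo_lin r c c' :
  combo (scale_combo r c ++ c') = (fun x => r * combo c x + combo c' x).
Proof.
apply/funext => x; rewrite /combo big_cat big_map/= mulr_sumr; congr (_ + _).
by apply: eq_bigr => t _; rewrite mulrA.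
Qed.

Lemma low_lin k r c c' : low k c -> low k c' -> low k (scale_combo r c ++ c').
Proof. by move=> lc lc'; rewrite /low all_cat all_map; apply/andP; split. Qed.

Lemma combo_mono i j : combo [:: (1, (i, j))] = m i j.
Proof. by apply/funext => x; rewrite /combo big_seq1 mul1r. Qed.

Lemma combo_nil : combo [::] = (fun=> 0).
Proof. by apply/funext => x; rewrite /combo big_nil. Qed.

Lemma degree_eigenvalue_inj : injective ev.
Proof.
move=> d d' /eqP; rewrite eqr_nat => /eqP dd'.
by nia.
Qed.

Section FixedDegree.
Variable k : nat.

(** The monomial, respectively the lower-order part of the Laplacian of a monomial,
    is the image under Delta + k (k + 1) of a polynomial of degree less than k. *)
Definition resolvent_at i j := exists2 c, low k c &
  solves (combo c) (fun x => m i j x - ev k * combo c x).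

Definition lower_at i j := exists2 c, low k c &
  solves (combo c) (fun x => (i * i.-1)%:R * m i.-2 j x + (j * j.-1)%:R * m i j.-2 x
     - ev k * combo c x).

(** For p <= 1 the factor p (p - 1) is zero; this covers the cases where the exponent
    p - 2 would be negative. *)
Lemma scaled_resolvent (p : nat) i j : ((1 < p)%N -> resolvent_at i j) ->
  exists2 c, low k c &
    solves (combo c) (fun x => (p * p.-1)%:R * m i j x - ev k * combo c x).
Proof.
have [p1|p1] := leqP p 1.
  move=> _; exists [::] => //; rewrite combo_nil.
  apply: solves_eq (solves0 n bc) => x _.
  by rewrite mulr0 subr0; case: p p1 => [|[|p]]// _; rewrite ?muln0 mul0r.
move=> /(_ isT)[c lc sc]; exists (scale_combo (p * p.-1)%:R c ++ [::]); first exact: low_lin.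
rewrite combo_lin combo_nil.
apply: solves_eq (solves_lin (p * p.-1)%:R sc (solves0 n bc)) => x _ /=.
by move: ((p * p.-1)%:R) => r; ring.
Qed.

Lemma lower_of_resolvent i j :
  ((1 < i)%N -> resolvent_at i.-2 j) -> ((1 < j)%N -> resolvent_at i j.-2) -> lower_at i j.
Proof.
move=> /scaled_resolvent[c lc sc] /scaled_resolvent[c' lc' sc'].
exists (scale_combo 1 c ++ c'); first exact: low_lin.
rewrite combo_lin; apply: solves_eq (solves_lin 1 sc sc') => x _ /=.
by move: ((i * _)%:R) ((j * _)%:R) => r r'; ring.
Qed.

(** On a monomial of degree D < k the operator Delta + k (k + 1) is multiplication by
    the nonzero number r = k (k + 1) - D (D + 1) up to terms of lower degree, which
    are dealt with by induction. *)
Lemma resolvent_exists i j : (i + j + parity < k)%N -> resolvent_at i j.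
Proof.
have [d] := ubnP (i + j); elim: d i j => // d IH i j ijd ijk.
have [c lc sc] : lower_at i j.
  by apply: lower_of_resolvent => p1; apply: IH; lia.
have evn : ev k - ev (i + j + parity) != 0.
  by rewrite subr_eq0; apply/eqP => /degree_eigenvalue_inj; lia.
set r := ev k - _ in evn.
have lm : low k [:: (1, (i, j))] by rewrite /low/= ijk.
have lc' := low_lin (- r^-1) lc (low_lin r^-1 lm (isT : low k [::])).
exists (scale_combo (- r^-1) c ++ (scale_combo r^-1 [:: (1, (i, j))] ++ [::])) => //.
rewrite !combo_lin combo_mono combo_nil.
apply: solves_eq (solves_lin (- r^-1) sc (solves_lin r^-1 (solves_mono F bc i j)
  (solves0 n bc))) => x _.
have -> : ev (i + j + parity) = ev k - r by rewrite /r; ring.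
move: ((i * _)%:R) ((j * _)%:R) (ev k) => q q' l.
move: (m i j x) (m i.-2 j x) (m i j.-2 x) (combo c x) => x1 x2 x3 x4.
by field.
Qed.

(** On a monomial of degree k the operator Delta + k (k + 1) leaves only the
    lower-order part, which is then corrected away. *)
Lemma eigenfunction_exists i j : (i + j + parity = k)%N -> exists2 c, low k c &
  E (ev k) (fun x => m i j x + combo c x).
Proof.
move=> ijk; have [c lc sc] : lower_at i j.
  by apply: lower_of_resolvent => p1; apply: resolvent_exists; lia.
exists (scale_combo (-1) c ++ [::]); first exact: low_lin.
apply/eigenspace_bcE; rewrite combo_lin combo_nil.
have := solves_lin (-1) sc (solves_mono F bc i j); rewrite ijk => sm.
rewrite (_ : (fun x => _ + _) = (fun x => -1 * combo c x + m i j x)); last first.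
  by apply/funext => x; rewrite addr0 addrC.
apply: solves_eq sm => x _ /=.
by move: ((i * _)%:R) ((j * _)%:R) => r r'; ring.
Qed.

Notation N := (k.+1 - parity)%N.

Lemma index_degree (i : 'I_N) : (i + (k - parity - i) + parity = k)%N.
Proof. by case: i => i /=; lia. Qed.

(** The point of the hemisphere above t (p, q); the factor z is the common power of
    the height, nonzero because t < 1. *)
Lemma disk_point (p q t : R) : p ^+ 2 + q ^+ 2 <= 1 -> 0 < t < 1 ->
  exists2 x, H x & exists2 z : R, z != 0 &
    forall i j, m i j x = t ^+ (i + j) * (p ^+ i * q ^+ j) * z.
Proof.
move=> pq /andP[t0 t1].
pose w := 1 - ((t * p) ^+ 2 + (t * q) ^+ 2).
have w0 : 0 < w.
  have : t ^+ 2 * (p ^+ 2 + q ^+ 2) <= t ^+ 2 * 1 by rewrite ler_wpM2l ?sqr_ge0.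
  have : t ^+ 2 < 1 by rewrite exprn_ilt1 ?ltW.
  by rewrite /w !exprMn; lra.
pose x := comb a b n (t * p) (t * q) (Num.sqrt w).
exists x.
  split; last by rewrite (dot_comb_n F) sqrtr_ge0.
  apply/sphere2P; rewrite (dot_comb F) -!expr2 sqr_sqrtr ?ltW// /w; ring.
exists (Num.sqrt w ^+ parity); first by rewrite expf_neq0// sqrtr_eq0 -ltNge.
move=> i j; rewrite /mono (dot_comb_a F) (dot_comb_b F) (dot_comb_n F).
by rewrite !exprMn exprD; ring.
Qed.

(** Restricted to the ray t (p, q), the combination is a polynomial in t whose
    coefficient of highest degree is the combination of the leading terms at (p, q).
    That one therefore vanishes on the disk, and for q = 1/2 it is a polynomial in p
    with coefficients c i up to powers of 2. *)
Lemma leading_terms_free (cc : 'I_N -> seq (R * (nat * nat))) (c : 'I_N -> R) :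
  (forall i, low k (cc i)) ->
  (forall x, H x ->
    \sum_(i < N) c i * (m i (k - parity - i) x + combo (cc i) x) = 0) ->
  forall i, c i = 0.
Proof.
move=> lcc c0.
pose K := (k - parity)%N.
have top p q : p ^+ 2 + q ^+ 2 <= 1 -> \sum_(i < N) c i * (p ^+ i * q ^+ (K - i)) = 0.
  move=> pq.
  pose P : {poly R} := \sum_(i < N) c i *: ((p ^+ i * q ^+ (K - i)) *: 'X^K +
    \sum_(t <- cc i) (t.1 * (p ^+ t.2.1 * q ^+ t.2.2)) *: 'X^(t.2.1 + t.2.2)).
  have P0 : P = 0.
    apply: (poly_eq0_of_itv ltr01) => t t01.
    have [x Hx [z z0 mx]] := disk_point pq t01.
    apply: (mulIf z0); rewrite mul0r -(c0 x Hx) /P horner_sum mulr_suml.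
    apply: eq_bigr => i _; rewrite hornerZ hornerD hornerZ hornerXn horner_sum.
    rewrite -mulrA; congr (_ * _); rewrite mulrDl mx; congr (_ + _).
      rewrite -/K subnKC ?[_ * t ^+ _]mulrC//; have := index_degree i; rewrite -/K; lia.
    rewrite /combo mulr_suml; apply: eq_bigr => s _.
    by rewrite hornerZ hornerXn mx; ring.
  have : P`_K = 0 by rewrite P0 coef0.
  rewrite /P coef_sum => {2}<-; apply: eq_bigr => i _.
  rewrite coefZ coefD coefZ coefXn eqxx mulr1 coef_sum big_seq big1 ?addr0// => s si.
  rewrite coefZ coefXn; have /allP/(_ s si) := lcc i.
  by case: eqP => [|_ _]; [rewrite /K; lia|rewrite mulr0].
pose P : {poly R} := \sum_(i < N) (c i * (1 / 2) ^+ (K - i)) *: 'X^i.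
have P0 : P = 0.
  have half0 : 0 < 1 / 2 :> R by rewrite divr_gt0.
  apply: (poly_eq0_of_itv half0) => t /andP[t0 t2].
  rewrite -[RHS](top t (1 / 2)); last by nra.
  rewrite horner_sum; apply: eq_bigr => i _; rewrite hornerZ hornerXn; ring.
move=> i; have : P`_i = 0 by rewrite P0 coef0.
rewrite /P coef_sum (bigD1 i)//= big1 => [|j ji]; last first.
  by rewrite coefZ coefXn (_ : _ == _ = false) ?mulr0//; apply/negbTE; rewrite eq_sym.
rewrite coefZ coefXn eqxx mulr1 addr0 => /eqP; rewrite mulf_eq0 expf_eq0.
by rewrite mul1r invr_eq0 pnatr_eq0/= andbF orbF => /eqP.
Qed.

Lemma eigenspace_lin mu r u v : E mu u -> E mu v -> E mu (fun x => r * u x + v x).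
Proof.
move=> /eigenspace_bcE su /eigenspace_bcE sv; apply/eigenspace_bcE.
by apply: solves_eq (solves_lin r su sv) => x _ /=; ring.
Qed.

Lemma eigenspace_sum mu N' (c : 'I_N' -> R) u : (forall i, E mu (u i)) ->
  E mu (fun x => \sum_(i < N') c i * u i x).
Proof.
move=> Eu; apply/eigenspace_bcE.
have := solves_sum c (fun i => (eigenspace_bcE n bc mu (u i)).1 (Eu i)).
apply: solves_eq => x _ /=; rewrite mulr_sumr.
by apply: eq_bigr => i _; rewrite mulrCA.
Qed.

Lemma hcont_eigen mu u : E mu u -> hcont a b n u.
Proof. by move=> /eigenspace_bcE; exact: hcont_solves. Qed.

Lemma moment_lin mu r u v i j : E mu u -> E mu v ->
  moment (fun x => r * u x + v x) i j = r * moment u i j + moment v i j.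
Proof.
move=> Eu Ev; have cm : hcont a b n (m i j) by exact: hcont_mono.
have cu := hcontM (hcont_eigen Eu) cm; have cv := hcontM (hcont_eigen Ev) cm.
rewrite /moment -(hintZ r cu) -(hintD (hcontZ cu) cv).
by apply: eq_rint => z _; congr (_ * _); rewrite mulrDl mulrA.
Qed.

Lemma moment_sum mu N' (c : 'I_N' -> R) u i j : (forall l, E mu (u l)) ->
  moment (fun x => \sum_(l < N') c l * u l x) i j = \sum_(l < N') c l * moment (u l) i j.
Proof.
elim: N' c u => [|N' IH] c u Eu.
  have cm : hcont a b n (m i j) by exact: hcont_mono.
  rewrite big_ord0 -[RHS](mul0r (hint a b n (m i j))) -(hintZ 0 cm).
  by apply: eq_rint => z _; rewrite big_ord0.
rewrite big_ord_recl -IH// -(moment_lin _ _ _ (Eu ord0)); last exact: eigenspace_sum.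
by apply: eq_rint => z _; rewrite big_ord_recl.
Qed.

(** The eigenfunctions with prescribed leading terms are independent, and
    eigenfunctions are separated by their N moments of degree k.  So the square matrix
    of moments of these N eigenfunctions is invertible, and any eigenfunction has the
    same moments as, hence equals, a combination of them. *)
Lemma has_dim_eigenspace : has_dim_on H (E (ev k)) N.
Proof.
have /choice[cc Hcc] : forall i : 'I_N, exists c, low k c /\
    E (ev k) (fun x => m i (k - parity - i) x + combo c x).
  by move=> i; have [c lc Ec] := eigenfunction_exists (index_degree i); exists c.
pose e (i : 'I_N) x := m i (k - parity - i) x + combo (cc i) x.
have Ee i : E (ev k) (e i) by case: (Hcc i).
have free_e (c : 'I_N -> R) : (forall x, H x -> \sum_(i < N) c i * e i x = 0)
  -> forall i, c i = 0.
  by apply: leading_terms_free => i; case: (Hcc i).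
pose A : 'M[R]_N := \matrix_(i, l) moment (e i) l (k - parity - l).
(* All other moments follow from these by the recursion. *)
have determined u : E (ev k) u -> (forall l : 'I_N, moment u l (k - parity - l) = 0) ->
    forall x, H x -> u x = 0.
  move=> Eu Mu; apply: (eigenfunction_eq0 F Eu); apply: (moments_eq0 F Eu) => i j.
  move=> /degree_eigenvalue_inj ijk; have iN : (i < N)%N by lia.
  by have := Mu (Ordinal iN); rewrite /= (_ : (k - parity - i = j)%N)//; lia.
have uA : A \in unitmx.
  rewrite -row_free_unit; apply: inj_row_free => v vA.
  have v0 := free_e (fun i => v 0 i) _.
  apply/rowP => i; rewrite mxE; apply: v0.
  apply: determined; first exact: eigenspace_sum.
  move=> l; rewrite (moment_sum _ _ _ Ee).
  by move/rowP: vA => /(_ l); rewrite !mxE => vA; rewrite -[RHS]vA; apply: eq_bigr => j _;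
    rewrite mxE.
exists e; split => // u Eu.
pose y : 'rV[R]_N := \row_l moment u l (k - parity - l).
pose c := y *m invmx A.
exists (fun i => c 0 i) => x Hx; apply/eqP; rewrite -subr_eq0; apply/eqP.
have Es := eigenspace_sum (fun i => c 0 i) Ee.
suff M0 (l : 'I_N) : moment (fun x => -1 * (\sum_(i < N) c 0 i * e i x) + u x) l
  (k - parity - l) = 0.
  by have := determined _ (eigenspace_lin (-1) Es Eu) M0 x Hx; rewrite mulN1r addrC.
rewrite (moment_lin _ _ _ Es Eu) (moment_sum _ _ _ Ee) mulN1r addrC.
have /rowP/(_ l) : c *m A = y by rewrite /c -mulmxA mulVmx// mulmx1.
rewrite !mxE => <-; apply/eqP; rewrite subr_eq0; apply/eqP.
by apply: eq_bigr => j _; rewrite [A j l]mxE.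
Qed.

Lemma has_dim_eigenspace0 mu : (forall d, mu <> ev d) -> has_dim_on H (E mu) 0.
Proof.
move=> muN; exists (fun _ _ => 0); split => [[]//|c _ []//|u Eu].
exists (fun=> 0) => x Hx; rewrite big_ord0.
apply: (eigenfunction_eq0 F Eu _ Hx); apply: (moments_eq0 F Eu) => i j /esym.
by move=> /muN.
Qed.

End FixedDegree.

End Dimension.

(** * Enumeration of the eigenvalues *)

Section UniqueDimension.
Context {R : realType} {T : Type}.
Implicit Types (H : set T) (E : set (T -> R)).

Lemma has_dim_on_le H E p q : has_dim_on H E p -> has_dim_on H E q -> (q <= p)%N.
Proof.
move=> [e [_ _ span]] [f [Ef free _]].
have /choice[A HA] : forall i : 'I_q, exists c : 'I_p -> R, forall x, H x ->
    f i x = \sum_(j < p) c j * e j x by move=> i; exact/span/Ef.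
pose M : 'M[R]_(q, p) := \matrix_(i, j) A i j.
suff /eqP <- : row_free M by exact: rank_leq_col.
apply: inj_row_free => v vM; apply/rowP => i; rewrite mxE.
apply: (free (fun i => v 0 i)) => x Hx.
transitivity (\sum_(j < p) (v *m M) 0 j * e j x); last first.
  by rewrite vM big1// => j _; rewrite mxE mul0r.
under [RHS]eq_bigr => j _ do rewrite mxE mulr_suml.
rewrite exchange_big/=; apply: eq_bigr => l _; rewrite (HA l x Hx) mulr_sumr.
by apply: eq_bigr => j _; rewrite mxE mulrA.
Qed.

Lemma has_dim_on_unique H E p q : has_dim_on H E p -> has_dim_on H E q -> p = q.
Proof.
by move=> hp hq; apply/eqP; rewrite eqn_leq (has_dim_on_le hp hq) (has_dim_on_le hq hp).
Qed.

End UniqueDimension.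

Section Blocks.

(** The index set is cut into consecutive blocks of sizes 1, 2, 3, ..., the
    multiplicities in increasing order: block d carries the eigenvalue of degree
    d + parity. *)
Definition block_start d := 'C(d.+1, 2).

Lemma block_startS d : block_start d.+1 = (block_start d + d.+1)%N.
Proof. by rewrite /block_start binS bin1 addnC. Qed.

Lemma block_start_mono : {homo block_start : d e / (d <= e)%N}.
Proof.
by apply: homo_leq => // [e d f|d]; [exact: leq_trans|rewrite block_startS leq_addr].
Qed.

Lemma block_exists j : exists d, (block_start d <= j < block_start d.+1)%N.
Proof.
elim: j => [|j [d /andP[dj jd]]]; first by exists 0%N.
have [jd'|jd'] := ltnP j.+1 (block_start d.+1); first by exists d; rewrite leqW.
by exists d.+1; rewrite jd' block_startS; lia.
Qed.

Definition block j := projT1 (cid (block_exists j)).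

Lemma blockP j : (block_start (block j) <= j < block_start (block j).+1)%N.
Proof. by rewrite /block; case: cid. Qed.

Lemma block_lt j d : (block j < d)%N = (j < block_start d)%N.
Proof.
have /andP[h1 h2] := blockP j; apply/idP/idP => [bd|].
  exact: leq_trans h2 (block_start_mono bd).
by rewrite !ltnNge; apply: contra => /block_start_mono bd; exact: leq_trans bd h1.
Qed.

Lemma block_eq j d : (block j == d) = (block_start d <= j < block_start d.+1)%N.
Proof. by rewrite eqn_leq -ltnS block_lt andbC leqNgt block_lt -leqNgt. Qed.

Lemma block_mono : {homo block : i j / (i <= j)%N}.
Proof.
move=> i j ij; rewrite -ltnS block_lt (leq_ltn_trans ij)//.
by have /andP[] := blockP j.
Qed.

Lemma card_block d : ([set j | block j = d] #= `I_(d.+1))%card.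
Proof.
have -> : [set j | block j = d] = (fun i => block_start d + i)%N @` `I_(d.+1).
  apply/seteqP; split => [j /= /eqP|_ /= [i id <-]].
    rewrite block_eq block_startS => /andP[h1 h2].
    by exists (j - block_start d)%N; lia.
  by apply/eqP; rewrite block_eq block_startS leq_addr ltn_add2l.
by apply: inj_card_eq => i j _ _; exact: addnI.
Qed.

End Blocks.

Section Spectrum.
Context {R : realType} (n : 'rV[R]_3).
Hypothesis hn : sphere2 n.
Variable bc : boundary_condition.
Notation parity := (parity bc).
Notation ev := (@degree_eigenvalue R).
Notation E := (eigenspace_bc bc n).

Definition multiplicity d : nat := (d.+1 - parity)%N.

Lemma has_dim_ev d : has_dim_on (hemisphere n) (E (ev d)) (multiplicity d).
Proof. by have [a [b F]] := orthoframe_exists hn; exact: (has_dim_eigenspace F). Qed.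

Lemma has_dim_not_ev mu : (forall d, mu <> ev d) -> has_dim_on (hemisphere n) (E mu) 0.
Proof. by have [a [b F]] := orthoframe_exists hn; exact: (has_dim_eigenspace0 F). Qed.

Lemma ev_le d e : (ev d <= ev e) = (d <= e)%N.
Proof.
rewrite ler_nat; apply/idP/idP => [|de]; last by rewrite leq_mul.
by apply: contraLR; rewrite -!ltnNge => ed; nia.
Qed.

Lemma ev_ge d : d%:R <= ev d.
Proof. by rewrite ler_nat leq_pmulr. Qed.

Lemma eigenvalues_exist : enumerates_eigenvalues bc n (fun j => ev (block j + parity)).
Proof.
split.
- by [].
- by move=> i j ij; rewrite ev_le leq_add2r block_mono.
- apply/cvgryPge => A.
  have [d Ad] : exists d : nat, A <= d%:R.
    by exists (Num.truncn A).+1; rewrite ltW// truncnS_gt.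
  exists (block_start d) => // j /= dj.
  rewrite (le_trans Ad)// (le_trans _ (ev_ge _))// ler_nat.
  by rewrite (leq_trans _ (leq_addr _ _))// leqNgt block_lt -leqNgt.
- move=> mu; have [[d ->]|mud] := pselect (exists d, mu = ev d); last first.
    exists 0%N; split; first by apply: has_dim_not_ev => d mudE; apply: mud; exists d.
    have -> : [set j | ev (block j + parity) = mu] = set0.
      by apply/seteqP; split => // j /= jmu; apply: mud; eexists; rewrite -jmu.
    by rewrite II0.
  exists (multiplicity d); split; first exact: has_dim_ev.
  have [pd|dp] := leqP parity d; last first.
    have -> : [set j | ev (block j + parity) = ev d] = set0.
      by apply/seteqP; split => // j /= /degree_eigenvalue_inj; lia.
    have -> : multiplicity d = 0%N by rewrite /multiplicity; lia.
    by rewrite II0.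
  have -> : multiplicity d = (d - parity).+1 by rewrite /multiplicity; lia.
  have -> : [set j | ev (block j + parity) = ev d] = [set j | block j = (d - parity)%N].
    by apply/seteqP; split => j /= => [/degree_eigenvalue_inj|->]; [lia|rewrite subnK].
  exact: card_block.
Qed.

(** As an enumeration exists, the selected sequence is one, and the counting function
    is computed from that property alone. *)
Lemma eigenvaluesP : enumerates_eigenvalues bc n (eigenvalues bc n).
Proof. exact: (getPex (ex_intro _ _ eigenvalues_exist)). Qed.

Lemma card_level d : ([set j | eigenvalues bc n j = ev d] #= `I_(multiplicity d))%card.
Proof.
have [_ _ _ /(_ (ev d))[p [dp card]]] := eigenvaluesP.
by rewrite (has_dim_on_unique (has_dim_ev d) dp).
Qed.

(** Any other number has an eigenspace of dimension 0, so it is taken no times. *)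
Lemma eigenvalue_is_ev j : exists d, eigenvalues bc n j = ev d.
Proof.
apply: contrapT => H; have [_ _ _ /(_ (eigenvalues bc n j))[p [dp card]]] := eigenvaluesP.
have p0 : p = 0%N.
  by apply: has_dim_on_unique dp _; apply: has_dim_not_ev => d dE; apply: H; exists d.
move: card; rewrite p0 II0 card_eq0 => /eqP/seteqP[/(_ j)/= /(_ erefl)].
by [].
Qed.

Lemma card_levels M : finite_set [set j | exists2 d, (d < M)%N & eigenvalues bc n j = ev d] /\
  #|` fset_set [set j | exists2 d, (d < M)%N & eigenvalues bc n j = ev d]|
  = (\sum_(d < M) multiplicity d)%N.
Proof.
elim: M => [|M [fin IH]].
  have -> : [set j | exists2 d, (d < 0)%N & eigenvalues bc n j = ev d] = set0.
    by apply/seteqP; split => // j [].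
  by split => //; rewrite fset_set0 big_ord0 cardfs0.
have -> : [set j | exists2 d, (d < M.+1)%N & eigenvalues bc n j = ev d] =
    [set j | exists2 d, (d < M)%N & eigenvalues bc n j = ev d] `|`
    [set j | eigenvalues bc n j = ev M].
  apply/seteqP; split => j /=.
    by move=> [d]; rewrite ltnS leq_eqVlt => /orP[/eqP -> jd|dM jd]; [right|left; exists d].
  by move=> [[d dM jd]|jd]; [exists d => //; exact: ltnW|exists M].
have finM : finite_set [set j | eigenvalues bc n j = ev M].
  by apply/finite_setP; exists (multiplicity M); exact: card_level.
split; first by rewrite finite_setU.
rewrite fset_setU// cardfsU -fset_setI//.
have -> : [set j | exists2 d, (d < M)%N & eigenvalues bc n j = ev d] `&`
    [set j | eigenvalues bc n j = ev M] = set0.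
  apply/seteqP; split => // j /= [[d dM ->]] /degree_eigenvalue_inj dE.
  by rewrite dE ltnn in dM.
by rewrite fset_set0 cardfs0 subn0 IH big_ord_recr/= (card_fset_set (card_level M)).
Qed.

Lemma eigenvalue_countE t M : (forall d, (ev d <= t) = (d < M)%N) ->
  eigenvalue_count bc n t = (\sum_(d < M) multiplicity d)%:R.
Proof.
move=> tM; rewrite /eigenvalue_count; congr (_%:R); rewrite -(card_levels M).2.
congr (#|` fset_set _ |); apply/seteqP; split => j /=.
  by have [d ->] := eigenvalue_is_ev j; rewrite tM => dM; exists d.
by move=> [d dM ->]; rewrite tM.
Qed.

End Spectrum.

(** * Integral of the counting function *)

Section StepIntegral.
Context {R : realType}.
Notation mu := (@lebesgue_measure R).

Lemma integrable_jump (l t : R) :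
  mu.-integrable `[0, t]%classic (EFin \o (\1_(`[l, t]%classic) : R -> R)).
Proof.
have mt : measurable (`[0, t]%classic : set (measurableTypeR R)) by exact: measurable_itv.
apply: (integrableS measurableT mt (@subsetT _ _)).
exact: integrable_indic_itv.
Qed.

Lemma Rintegral_jump (l t : R) : 0 <= l <= t ->
  \int[mu]_(s in `[0, t]%classic) (\1_(`[l, t]%classic) s : R) = t - l.
Proof.
move=> /andP[l0 lt].
have m0 : measurable (`[0, t]%classic : set (measurableTypeR R)) by exact: measurable_itv.
have m1 : measurable (`[l, t]%classic : set (measurableTypeR R)) by exact: measurable_itv.
rewrite /Rintegral (integral_indic _ m0 m1) setIidl; last first.
  by move=> s /=; rewrite !in_itv/= => /andP[ls ->]; rewrite (le_trans l0).
have E : mu `[l, t]%classic = (t - l)%:E.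
  apply: etrans (lebesgue_measure_itv `[l, t]) _.
  by rewrite /= lte_fin; case: ltgtP lt => // -> _; rewrite subrr.
exact: (congr1 fine E).
Qed.

Lemma Rintegral_jumps N (c l : 'I_N -> R) (t : R) : (forall i, 0 <= l i <= t) ->
  mu.-integrable `[0, t]%classic (EFin \o (fun s => \sum_(i < N) c i * \1_(`[l i, t]%classic)
    s)) /\
  \int[mu]_(s in `[0, t]%classic) (\sum_(i < N) c i * \1_(`[l i, t]%classic) s) =
  \sum_(i < N) c i * (t - l i).
Proof.
elim: N c l => [|N IH] c l lt.
  have -> : (fun s => \sum_(i < 0) c i * \1_(`[l i, t]%classic) s) = (fun=> 0).
    by apply/funext => s; rewrite big_ord0.
  rewrite big_ord0; split; first exact: integrable0.
  by rewrite /Rintegral integral0.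
have [i1 i2] := IH (fun i => c (lift ord0 i)) (fun i => l (lift ord0 i)) (fun i => lt
  (lift ord0 i)).
have -> : (fun s => \sum_(i < N.+1) c i * \1_(`[l i, t]%classic) s) = (fun s =>
    c ord0 * \1_(`[l ord0, t]%classic) s + \sum_(i < N) c (lift ord0 i) * \1_(`[l
      (lift ord0 i), t]%classic) s).
  by apply/funext => s; rewrite big_ord_recl.
have mt : measurable (`[0, t]%classic : set (measurableTypeR R)) by exact: measurable_itv.
have j1 : mu.-integrable `[0, t]%classic (EFin \o
  (fun s => c ord0 * \1_(`[l ord0, t]%classic) s)).
  rewrite (_ : EFin \o _ = (fun s => (c ord0)%:E * ((\1_(`[l ord0, t]%classic) s)%:E))%E).
    by apply: integrableZl => //; exact: integrable_jump.
  by apply/funext => s; rewrite /= EFinM.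
split.
  rewrite (_ : EFin \o _ = (fun s => (c ord0 * \1_(`[l ord0, t]%classic) s)%:E +
    (\sum_(i < N) c (lift ord0 i) * \1_(`[l (lift ord0 i), t]%classic) s)%:E)%E).
    exact: integrableD.
  by apply/funext => s; rewrite /= EFinD.
rewrite RintegralD// i2 big_ord_recl; congr (_ + _).
by rewrite RintegralZl ?Rintegral_jump//; exact: integrable_jump.
Qed.

End StepIntegral.

Section CountingFunction.
Context {R : realType}.
Notation ev := (@degree_eigenvalue R).

Lemma ev_sqr (d : nat) : ev d = (d%:R + 1 / 2) ^+ 2 - 1 / 4.
Proof. by rewrite /degree_eigenvalue natrM -addn1 natrD; field. Qed.

Definition degree_count (t : R) : nat := Num.truncn (Num.sqrt (t + 1 / 4) + 1 / 2).

(** As d (d + 1) = (d + 1/2)^2 - 1/4, the condition is d + 1 <= sqrt (t + 1/4) + 1/2. *)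
Lemma degree_countP (t : R) d : 0 <= t -> (ev d <= t) = (d < degree_count t)%N.
Proof.
move=> t0; have t4 : 0 <= t + 1 / 4 by lra.
rewrite /degree_count truncn_gt_nat.
rewrite ev_sqr lerBlDr -{1}(sqr_sqrtr t4) ler_sqr ?nnegrE ?sqrtr_ge0 ?addr_ge0//.
by rewrite -[d.+1%:R]natr1; apply/idP/idP => H; lra.
Qed.

End CountingFunction.

(** * The averaged error *)

Section AveragedError.
Context {R : realType} (n : 'rV[R]_3).
Hypothesis hn : sphere2 n.
Variable bc : boundary_condition.
Notation mu := (@lebesgue_measure R).
Notation ev := (@degree_eigenvalue R).

Definition bc_sign : R := match bc with Neumann => 1 | Dirichlet => -1 end.

Lemma NtildeE s : Ntilde bc s = 1 / 2 * s + bc_sign * (1 / 2 * Num.sqrt (s + 1 / 4)) + 1 / 6.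
Proof. by rewrite /Ntilde /bc_sign; case: bc; rewrite ?mul1r ?mulN1r. Qed.

(** The product (s + 1/4) sqrt (s + 1/4) is the power 3/2, written so that it can be
    differentiated by the product rule. *)
Definition Ntilde_primitive (s : R) : R :=
  s ^+ 2 / 4 + bc_sign / 3 * ((s + 1 / 4) * Num.sqrt (s + 1 / 4)) + s / 6.

Lemma is_derive_Ntilde_primitive (s : R) : 0 <= s ->
  is_derive s (1 : R) Ntilde_primitive (Ntilde bc s).
Proof.
move=> s0; have s4 : 0 < s + 1 / 4 by lra.
have di := is_derive_id s (1 : R).
have dc := is_derive_funD di (is_derive_fun_cst (1 / 4) s (1 : R)).
have dr := is_derive_fun_comp (f := fun r : R => r + 1 / 4) (is_derive1_sqrt s4) dc.
have d1 := is_derive_cMr (4^-1) (is_derive_funX 2 di).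
have d2 := is_derive_cMl (bc_sign / 3) (is_derive_funM dc dr).
have d3 := is_derive_cMr (6^-1) di.
apply: (is_derive_eq (is_derive_funD (is_derive_funD d1 d2) d3)).
rewrite NtildeE; have r0 : Num.sqrt (s + 1 / 4) != 0 by rewrite sqrtr_eq0 -ltNge.
have rr : s + 1 / 4 = Num.sqrt (s + 1 / 4) ^+ 2 by rewrite sqr_sqrtr// ltW.
move: (Num.sqrt _) r0 rr => r r0 rr; rewrite {1}rr /=.
by field.
Qed.

Lemma continuous_Ntilde (s : R) : {for s, continuous (@Ntilde R bc)}.
Proof.
rewrite (_ : Ntilde bc = (fun s => 1 / 2 * s + bc_sign * (1 / 2 * Num.sqrt (s + 1 / 4)) + 1 / 6));
  last by apply/funext => r; exact: NtildeE.
have cc (k : R) : {for s, continuous (fun _ : R => k)} by exact: cst_continuous.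
have ci : {for s, continuous (fun r : R => r)} by exact: cvg_id.
apply: continuous_funD => //; apply: continuous_funD; apply: continuous_funM => //.
apply: continuous_funM => //; apply: (@continuous_comp _ _ _ (fun r : R => r + 1 / 4) Num.sqrt).
  exact: continuous_funD.
exact: sqrt_continuous.
Qed.

Lemma integral_Ntilde (t : R) : 0 < t -> mu.-integrable `[0, t]%classic (EFin \o @Ntilde R bc) /\
  \int[mu]_(s in `[0, t]%classic) Ntilde bc s = Ntilde_primitive t - Ntilde_primitive 0.
Proof.
move=> t0; split.
  apply: continuous_compact_integrable; first exact: segment_compact.
  by apply: continuous_in_subspaceT => s _; exact: continuous_Ntilde.
have dN s : 0 <= s <= t -> is_derive s (1 : R) Ntilde_primitive (Ntilde bc s).
  by move=> /andP[s0 _]; exact: is_derive_Ntilde_primitive.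
have cN s : 0 <= s <= t -> {for s, continuous (@Ntilde R bc)}.
  by move=> _; exact: continuous_Ntilde.
by rewrite /Rintegral (integral_is_derive t0 dN cN).
Qed.

(** Both boundary conditions at once: the multiplicities below m add up to
    m (m + 1) / 2 or m (m - 1) / 2, and the last two terms are minus the sum
    of multiplicity times d (d + 1). *)
Definition level_sum (t m : R) : R := t * m * (m + bc_sign) / 2
  - (m * (m + bc_sign) / 2) ^+ 2 + bc_sign * m * (m + bc_sign) * (2 * m + bc_sign) / 6.

Lemma level_sumE (t : R) M :
  \sum_(d < M) (multiplicity bc d)%:R * (t - ev d) = level_sum t M%:R.
Proof.
elim: M => [|M IH]; first by rewrite big_ord0 /level_sum; field.
rewrite big_ord_recr/= IH /level_sum /degree_eigenvalue natrM -natr1.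
rewrite /multiplicity /parity /bc_sign; case: bc; rewrite ?subn0 ?subn1/= -?natr1; by field.
Qed.

(** The counting function is the sum, over d, of multiplicity times a jump at
    d (d + 1), and such a jump has integral t - d (d + 1) over [0, t]. *)
Lemma averaged_errorE (t : R) : 0 < t -> averaged_error bc n t = 1 / t *
  (level_sum t (degree_count t)%:R - (Ntilde_primitive t - Ntilde_primitive 0)).
Proof.
move=> t0; rewrite /averaged_error; congr (_ * _).
set M := degree_count t.
have lt (d : 'I_M) : 0 <= ev d <= t by rewrite ler0n (degree_countP _ (ltW t0)) ltn_ord.
have [i1 e1] := Rintegral_jumps (fun d : 'I_M => (multiplicity bc d)%:R) lt.
have [i2 e2] := integral_Ntilde t0.
have mt : measurable (`[0, t]%classic : set (measurableTypeR R)) by exact: measurable_itv.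
rewrite -e2 -level_sumE -e1 -(RintegralB mt i1 i2).
apply: eq_Rintegral => s /set_mem/=; rewrite in_itv/= => /andP[s0 st].
have Hs d : (ev d <= s) = (d < degree_count s)%N by exact: degree_countP.
congr (_ - _); rewrite (eigenvalue_countE hn bc Hs) natr_sum.
have sM : (degree_count s <= M)%N.
  rewrite leqNgt -(degree_countP _ s0); apply/negP => Ms.
  by have := degree_countP M (ltW t0); rewrite (le_trans Ms st) /M ltnn.
rewrite (big_ord_widen _ (fun d => (multiplicity bc d)%:R) sM) big_mkcond/=.
apply: eq_bigr => d _; rewrite indicE -(degree_countP _ s0).
have -> : (s \in (`[ev d, t]%classic : set R)) = (ev d <= s).
  by apply/idP/idP => [/set_mem/=|ds]; rewrite ?in_itv/= ?st ?andbT//; apply/mem_set;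
    rewrite /= in_itv/= ds.
by case: ifP => _; rewrite ?mulr1 ?mulr0.
Qed.

(** The signed distance from x to a nearest integer. *)
Definition frac_offset (x : R) : R := x - (Num.floor (x + 1 / 2))%:~R.

Lemma frac_offset_itv x : - (1 / 2) <= frac_offset x <= 1 / 2.
Proof.
have := floor_itv (x + 1 / 2); rewrite /frac_offset intrD.
by move: ((Num.floor _)%:~R) => m /andP[]; rewrite mulr1z => h1 h2; apply/andP; split; lra.
Qed.

Lemma degree_count_floor (t : R) :
  (degree_count t)%:R = (Num.floor (Num.sqrt (t + 1 / 4) + 1 / 2))%:~R :> R.
Proof.
rewrite /degree_count; set y := _ + _.
have y0 : 0 <= y by rewrite addr_ge0 ?sqrtr_ge0.
by rewrite truncn_floor// y0 natr_absz ger0_norm ?floor_ge0.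
Qed.

(** Here t = x^2 - 1/4 and m = x - d.  The terms of degree 4 and 3 in x cancel
    between the integrals of the counting function and of the comparison function,
    and the term of degree 2 is accounted for by t (1/12 - d^2). *)
Lemma level_sum_expansion (x d : R) :
  level_sum (x ^+ 2 - 1 / 4) (x - d) - ((x ^+ 2 - 1 / 4) ^+ 2 / 4
    + bc_sign / 3 * (x ^+ 2 * x - 1 / 8) + (x ^+ 2 - 1 / 4) / 6)
  - (x ^+ 2 - 1 / 4) * (1 / 12 - d ^+ 2) =
  x * (d ^+ 3 - bc_sign * d ^+ 2 / 2 - d / 4 + bc_sign / 24) +
  (- d ^+ 4 / 4 + bc_sign * d ^+ 3 / 6 - d ^+ 2 / 8 - bc_sign * d / 24 +
   (9 + 8 * bc_sign) / 192).
Proof. by rewrite /level_sum /bc_sign; case: bc; field. Qed.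

Lemma remainder_le (x d : R) : 1 <= x -> - (1 / 2) <= d <= 1 / 2 ->
  `|x * (d ^+ 3 - bc_sign * d ^+ 2 / 2 - d / 4 + bc_sign / 24) +
  (- d ^+ 4 / 4 + bc_sign * d ^+ 3 / 6 - d ^+ 2 / 8 - bc_sign * d / 24 +
   (9 + 8 * bc_sign) / 192)| <= 2 * x.
Proof.
move=> x1 /andP[d1 d2].
have q : 0 <= d ^+ 2 <= 1 / 4 by rewrite sqr_ge0 andTb; nra.
have c : - (1 / 8) <= d ^+ 3 <= 1 / 8.
  by rewrite exprS; move: (d ^+ 2) q => D /andP[D0 D1]; apply/andP; split; nra.
have f : 0 <= d ^+ 4 <= 1 / 16.
  have -> : d ^+ 4 = d ^+ 2 * d ^+ 2 by rewrite -exprD.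
  by move: (d ^+ 2) q => D /andP[D0 D1]; apply/andP; split; nra.
move: (d ^+ 2) (d ^+ 3) (d ^+ 4) q c f => D2 D3 D4 /andP[a0 a1] /andP[b0 b1] /andP[e0 e1].
rewrite ler_norml; set u := D3 - _ - _ + _; set v := _ + _ / 192.
have /andP[u0 u1] : - 1 <= u <= 1 by rewrite /u /bc_sign; case: bc; lra.
have /andP[v0 v1] : - 1 <= v <= 1 by rewrite /v /bc_sign; case: bc; lra.
by apply/andP; split; nra.
Qed.

(** The remainder is at most 2 x, and x <= 2 sqrt t for t >= 1. *)
Lemma averaged_error_bound (t : R) : 1 <= t ->
  `|averaged_error bc n t - 1 / 2 * g (Num.sqrt (t + 1 / 4))| <= 4 * (Num.sqrt t)^-1.
Proof.
move=> t1; have t0 : 0 < t by lra.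
have t4 : 0 <= t + 1 / 4 by lra.
set x := Num.sqrt (t + 1 / 4); pose d := frac_offset x.
have xx : x ^+ 2 = t + 1 / 4 by rewrite sqr_sqrtr.
have x1 : 1 <= x by rewrite -sqrtr1 ler_wsqrtr//; lra.
have s0 : 0 < Num.sqrt t by rewrite sqrtr_gt0.
have ss : Num.sqrt t ^+ 2 = t by rewrite sqr_sqrtr// ltW.
have xs : x <= 2 * Num.sqrt t.
  by rewrite -ler_sqr ?nnegrE ?mulr_ge0 ?sqrtr_ge0// xx exprMn ss; lra.
have half : Num.sqrt (0 + 1 / 4) = 1 / 2 :> R.
  by rewrite add0r (_ : 1 / 4 = (1 / 2) ^+ 2); [rewrite sqrtr_sqr ger0_norm|field].
have P0 : Ntilde_primitive 0 = bc_sign / 24 by rewrite /Ntilde_primitive half; field.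
have Pt : Ntilde_primitive t = (x ^+ 2 - 1 / 4) ^+ 2 / 4 + bc_sign / 3 * (x ^+ 2 * x)
    + (x ^+ 2 - 1 / 4) / 6.
  by rewrite /Ntilde_primitive -/x -xx (_ : t = x ^+ 2 - 1 / 4)// xx addrK.
have tx : t = x ^+ 2 - 1 / 4 by rewrite xx addrK.
have mx : (degree_count t)%:R = x - d by rewrite degree_count_floor -/x /d /frac_offset opprB
  addrCA subrr addr0.
have gx : 1 / 2 * g x = 1 / 12 - d ^+ 2 by rewrite /g -/(frac_offset x) -/d; field.
rewrite averaged_errorE// gx mx.
have -> : 1 / t * (level_sum t (x - d) - (Ntilde_primitive t - Ntilde_primitive 0)) -
  (1 / 12 - d ^+ 2)
  = t^-1 * (level_sum t (x - d) - (Ntilde_primitive t - Ntilde_primitive 0) - t *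
    (1 / 12 - d ^+ 2)).
  by field; rewrite gt_eqF.
have -> : level_sum t (x - d) - (Ntilde_primitive t - Ntilde_primitive 0) - t * (1 / 12 - d ^+ 2)
  = x * (d ^+ 3 - bc_sign * d ^+ 2 / 2 - d / 4 + bc_sign / 24) +
  (- d ^+ 4 / 4 + bc_sign * d ^+ 3 / 6 - d ^+ 2 / 8 - bc_sign * d / 24 +
   (9 + 8 * bc_sign) / 192).
  rewrite -level_sum_expansion Pt P0 tx.
  by move: (level_sum _ _) => L; field.
rewrite normrM gtr0_norm ?invr_gt0// mulrC ler_pdivrMr//.
apply: (le_trans (remainder_le x1 (frac_offset_itv x))).
have -> : 4 * (Num.sqrt t)^-1 * t = 4 * Num.sqrt t.
  by move: (Num.sqrt t) s0 ss => s s0 <-; field; rewrite gt_eqF.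
by lra.
Qed.

End AveragedError.

Theorem theorem4p4 (R : realType) (n : 'rV[R]_3) (hn : sphere2 n)
  (b : boundary_condition) :
  exists2 C : R, 0 < C &
    \forall t \near +oo,
      `|averaged_error b n t - 1 / 2 * g (Num.sqrt (t + 1 / 4))|
        <= C * t `^ (- (1 / 2)).
Proof.
exists 4 => //; near=> t.
have t1 : 1 <= t by near: t; exact: nbhs_pinfty_ge.
have -> : t `^ (- (1 / 2)) = (Num.sqrt t)^-1.
  by rewrite powRN div1r powR12_sqrt// (le_trans ler01).
exact: averaged_error_bound.
Unshelve. all: by end_near. Qed.
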